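(* Let $G$ be a connected simple graph on $[n]$, let $K$ be a field, and let $S=K[x_1,\dots,x_n,y_1,\dots,y_n]$. Then $$\mathrm{v}(J_G)\le \mathrm{v}_{J_{\mathcal{K}_n}}(J_G)=\gamma_c(G)\le \operatorname{reg}(S/J_{T_G}),$$ where $T_G$ is a spanning tree of $G$ with the largest number of leaves.
   Context: $[n]=\{1,\dots,n\}$, and $\mathcal{K}_n$ is the complete graph on $[n]$. Graphs are finite and simple (no loops, no multiple edges). Binomial edge ideal: for a graph $H$ on $[n]$, $J_H=(x_iy_j-x_jy_i \mid \{i,j\}\in E(H),\ i<j)\subseteq S$, with $S$ standard graded. When $G$ is connected, $J_{\mathcal{K}_n}$ is a minimal prime of $J_G$. v-number: for a homogeneous ideal $I$ of $S=\bigoplus_{d\ge 0}S_d$, $\mathrm{v}(I):=\min\{d\ge 0\mid \exists f\in S_d \text{ and } \mathfrak{p}\in\operatorname{Ass}(I)\text{ with } (I:f)=\mathfrak{p}\}$, and for $\mathfrak{p}\in\operatorname{Ass}(I)$, $\mathrm{v}_{\mathfrak{p}}(I):=\min\{d\ge 0\mid \exists f\in S_d \text{ with } (I:f)=\mathfrak{p}\}$. Connected domination number: a connected dominating set of $G$ is a subset $D\subseteq V(G)$ whose induced subgraph is connected and such that every vertex of $V(G)\setminus D$ is adjacent to at least one vertex of $D$; $\gamma_c(G)$ is the minimum cardinality of such a set. A spanning tree of $G$ is a subgraph that is a tree and contains all the vertices of $G$; the non-leaf vertices of the tree are those of degree at least $2$ in it. Castelnuovo–Mumford regularity: if $b_{i,j}$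 are the graded Betti numbers of $S/I$ as an $S$-module (i.e. the $i$-th module of the minimal graded free resolution is $\bigoplus_j S(-j)^{b_{i,j}}$), then $\operatorname{reg}(S/I)=\max\{j-i\mid b_{i,j}\ne 0\}$.
   Formalization: The equality with the connected domination number is claimed only for non-complete G (for a complete graph the local v-number is 0 but γ_c = 1, so only ≤ is stated), and the bound γ_c(G) ≤ reg(S/J_{T_G}) only for n ≥ 2 (for n = 1, γ_c = 1 but reg = 0). *)

(* Defs.v *)
From HB Require Import structures.
From mathcomp Require Import all_boot all_order all_algebra.
From mathcomp Require Import mpoly.

Set Implicit Arguments.
Unset Strict Implicit.
Unset Printing Implicit Defensive.

Import Order.TTheory GRing.Theory Num.Theory.
Local Open Scope ring_scope.

(* Ideals are Prop-valued predicates: membership in an ideal of {mpoly K[m]}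
   is not decidable over an arbitrary field. *)
Section Ideals.
Variable R : comNzRingType.
Implicit Types (I P A : R -> Prop) (f g : R).

Definition ideal_gen A f : Prop :=
  exists s : seq (R * R),
    (forall p, p \in s -> A p.2) /\ f = \sum_(p <- s) p.1 * p.2.

Definition is_ideal I : Prop :=
  [/\ I 0, forall f g, I f -> I g -> I (f + g) & forall a f, I f -> I (a * f)].

Definition prime_ideal P : Prop :=
  [/\ is_ideal P, ~ P 1 & forall f g, P (f * g) -> P f \/ P g].

Definition colon I f : R -> Prop := fun g => I (g * f).

Definition same_ideal I P : Prop := forall f, I f <-> P f.

Definition associated_prime I P : Prop :=
  prime_ideal P /\ exists f, same_ideal (colon I f) P.

End Ideals.

Definition is_min (P : nat -> Prop) (d : nat) : Prop :=
  P d /\ forall k, P k -> (d <= k)%N.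

Section VNumber.
Variables (K : fieldType) (m : nat).
Implicit Types I P : {mpoly K[m]} -> Prop.

(* The zero polynomial is d.-homog for every d, so that d.-homog is S_d. *)
Definition is_v_number I : nat -> Prop :=
  is_min (fun d => exists (f : {mpoly K[m]}) (P : {mpoly K[m]} -> Prop),
    [/\ f \is d.-homog, associated_prime I P & same_ideal (colon I f) P]).

Definition is_local_v_number I P (d : nat) : Prop :=
  associated_prime I P /\
  is_min (fun k => exists f : {mpoly K[m]},
    f \is k.-homog /\ same_ideal (colon I f) P) d.

End VNumber.

Section FreeResolutions.
Variables (K : fieldType) (m : nat).
Local Notation S := {mpoly K[m]}.

(* The i-th module is the direct sum of the S(- shift i k), k < rk i, seen as
   row vectors; diff i is the matrix, acting on the right, of the map from the
   (i+1)-st module to the i-th one; the map from the 0-th module to S/I is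
   u |-> class of u *m aug. Shifts in nat are no restriction for minimal
   resolutions of S/I, since S/I lives in nonnegative degrees. *)
Record free_complex := FreeComplex {
  rk : nat -> nat;
  shift : forall i, 'I_(rk i) -> nat;
  diff : forall i, 'M[S]_(rk i.+1, rk i);
  aug : 'cV[S]_(rk 0)
}.

(* The maps have degree 0: the entry from the generator of degree a to the one
   of degree b is zero or homogeneous of degree a - b. *)
Definition graded_complex (F : free_complex) : Prop :=
  (forall i k l (mon : 'X_{1..m}), mon \in msupp (diff F i k l) ->
     (mdeg mon + shift l = shift k)%N) /\
  (forall k, aug F k 0 \is (shift k).-homog).

Definition resolves (I : S -> Prop) (F : free_complex) : Prop :=
  [/\ forall g : S, exists u : 'rV[S]_(rk F 0), I ((u *m aug F) 0 0 - g),
      forall u : 'rV[S]_(rk F 0),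
        I ((u *m aug F) 0 0) <-> exists w, u = w *m diff F 0
    & forall i (u : 'rV[S]_(rk F i.+1)),
        u *m diff F i = 0 <-> exists w, u = w *m diff F i.+1].

(* The image of each differential lies in (X_0, ..., X_(m-1)) times its
   target. *)
Definition minimal_complex (F : free_complex) : Prop :=
  forall i k l, (diff F i k l)@_(0%MM) = 0.

Definition minimal_graded_free_resolution (I : S -> Prop) (F : free_complex) :=
  [/\ graded_complex F, resolves I F & minimal_complex F].

Definition betti (F : free_complex) (i j : nat) : nat :=
  #|[set k : 'I_(rk F i) | shift k == j]|.

(* r = reg(S/I) *)
Definition is_regularity (I : S -> Prop) (r : int) : Prop :=
  exists F : free_complex,
    [/\ minimal_graded_free_resolution I F,
        exists i j : nat, betti F i j != 0%N /\ r = j%:Z - i%:Z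
      & forall i j : nat, betti F i j != 0%N -> j%:Z - i%:Z <= r].

End FreeResolutions.

Section Graphs.
Variable n : nat.
Implicit Types (e t : rel 'I_n) (D : {set 'I_n}).

Definition simple_graph e : Prop := ssrbool.symmetric e /\ irreflexive e.

Definition complete_graph : rel 'I_n := [rel i j | i != j].

Definition is_complete e : bool := [forall i, forall j, (i != j) ==> e i j].

Definition connected_graph e : Prop := forall i j, connect e i j.

Definition induced e D : rel 'I_n := [rel i j | [&& i \in D, j \in D & e i j]].

Definition connected_dominating e D : bool :=
  [forall i in D, forall j in D, connect (induced e D) i j] &&
  [forall i in ~: D, exists j in D, e i j].

(* The default value setT of the arg min is connected dominating as soon as
   the graph is connected. *)
Definition connected_domination_number e : nat :=
  #|[arg min_(D < [set: 'I_n] | connected_dominating e D) #|D| ]|.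

(* ucycle also accepts the sequences [:: i; j] with e i j and e j i. *)
Definition acyclic e : Prop :=
  forall c : seq 'I_n, ucycle e c -> (size c <= 2)%N.

Definition spanning_tree e t : Prop :=
  [/\ simple_graph t, subrel t e, connected_graph t & acyclic t].

Definition leaves t : {set 'I_n} := [set i | #|[set j | t i j]| == 1%N].

Definition max_leaf_spanning_tree e t : Prop :=
  spanning_tree e t /\
  forall t', spanning_tree e t' -> (#|leaves t'| <= #|leaves t|)%N.

(* In K[x_1..x_n, y_1..y_n] = {mpoly K[n + n]}, the x's are the first n
   variables and the y's the last n. *)
Definition xvar (K : fieldType) (i : 'I_n) :
    {mpoly K[n + n]} :=
  'X_(lshift n i).
Definition yvar (K : fieldType) (i : 'I_n) :
    {mpoly K[n + n]} :=
  'X_(rshift n i).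

Definition binomial_edge_ideal (K : fieldType) e : {mpoly K[n + n]} -> Prop :=
  ideal_gen (fun f => exists i j : 'I_n,
    [/\ (i < j)%N, e i j & f = xvar K i * yvar K j - xvar K j * yvar K i]).

End Graphs.

Arguments xvar {n} K i.
Arguments yvar {n} K i.
Arguments binomial_edge_ideal {n} K e _.

(* Main.v *)
(* Lower bound for the regularity.  Let t be a tree and F a free resolution of
   S/J_t whose h-th module is generated in degrees < 2h.  A Koszul h-cycle of
   internal degree h modulo J_t lifts through the double complex K (x) F down
   to an element of K_0 (x) F_h of positive degree, so it is a boundary modulo
   J_t.  Non-bounding cycles are grown together with the tree, by attaching
   leaves l to vertices v:
   if v is already in a set D of interior vertices the cycle is kept, and
   restricting to the old vertices shows that it still does not bound;
   otherwise v is a leaf of the old tree, f = x_v y_l - x_l y_v is regular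
   modulo the old ideal, and the cycle is multiplied by x_v dy_l - x_l dy_v,
   whose differential is f.  At the end D is connected dominating and #|D| <= h.

   v-numbers.  A multihomogeneous polynomial with support D lies in J_G as soon
   as it vanishes after identifying the y/x ratios inside each component of
   G[D].  Hence (J_G : prod_(v in D) x_v) = J_(K_n) for D connected dominating;
   conversely if (J_G : f) = J_(K_n), some multigraded component of f is not in
   J_G, and multiplying it by the binomials of all pairs of vertices shows that
   its support is connected dominating, unless G is complete. *)

Require Import Defs.
From HB Require Import structures.
From Stdlib Require Import Classical.
From mathcomp Require Import all_boot all_order all_algebra.
From mathcomp Require Import mpoly.
From mathcomp Require Import ring zify.

Set Implicit Arguments.
Unset Strict Implicit.
Unset Printing Implicit Defensive.

Import Order.TTheory GRing.Theory Num.Theory.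
Local Open Scope ring_scope.

(** * Components of polynomials *)

Section MonomialFilter.
Variables (K : comNzRingType) (m : nat).
Local Notation S := {mpoly K[m]}.
Implicit Types (P Q : pred 'X_{1..m}) (f g : S).

Definition mfilter P f : S := \sum_(u <- msupp f | P u) f@_u *: 'X_[u].

Lemma mcoeff_mfilter P f u : (mfilter P f)@_u = if P u then f@_u else 0.
Proof.
rewrite /mfilter raddf_sum /=.
under eq_bigr => v _ do rewrite mcoeffZ mcoeffX.
have [u_f|/memN_msupp_eq0 u_f] := boolP (u \in msupp f).
  rewrite big_mkcond (bigD1_seq u) ?msupp_uniq //= eqxx mulr1 big1 ?addr0 //.
  by move=> v /negPf vu; rewrite vu mulr0; case: ifP.
rewrite u_f if_same big1 // => v _.
by have [->|] := eqVneq v u; rewrite ?u_f ?mul0r ?mulr0.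
Qed.

Lemma mfilter_is_linear P : linear (mfilter P).
Proof.
move=> c f g; apply/mpolyP => u.
rewrite mcoeffD mcoeffZ !mcoeff_mfilter mcoeffD mcoeffZ.
by case: ifP => // _; rewrite mulr0 addr0.
Qed.

HB.instance Definition _ P :=
  GRing.isLinear.Build K S S _ (mfilter P) (mfilter_is_linear P).

Lemma eq_mfilter P Q f : P =1 Q -> mfilter P f = mfilter Q f.
Proof. by move=> PQ; apply/mpolyP => u; rewrite !mcoeff_mfilter PQ. Qed.

Lemma mfilterX P u : mfilter P 'X_[u] = if P u then 'X_[u] else 0.
Proof.
apply/mpolyP => v; rewrite mcoeff_mfilter mcoeffX.
have [<-|uv] := eqVneq u v; case: (P u); rewrite ?mcoeff0 ?mcoeffX ?eqxx //.
  by rewrite (negPf uv) if_same.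
by rewrite if_same.
Qed.

Lemma mem_msupp_mfilter P f u :
  (u \in msupp (mfilter P f)) = P u && (u \in msupp f).
Proof. by rewrite !mcoeff_msupp mcoeff_mfilter; case: ifP; rewrite ?eqxx. Qed.

Lemma mfilter_id P f : {in msupp f, forall u, P u} -> mfilter P f = f.
Proof.
move=> Pf; apply/mpolyP => u; rewrite mcoeff_mfilter; case: ifPn => // nPu.
by apply/esym/memN_msupp_eq0; apply: contra nPu => /Pf.
Qed.

Lemma mfilter_eq0 P f : {in msupp f, forall u, ~~ P u} -> mfilter P f = 0.
Proof.
move=> Pf; apply/mpolyP => u; rewrite mcoeff_mfilter mcoeff0; case: ifP => // Pu.
by apply/memN_msupp_eq0; apply/negP => /Pf; rewrite Pu.
Qed.

(** Products of monomials are filtered one by one. For [g] homogeneous in some grading, this says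
    that taking components commutes with multiplication by [g], up to the shift from [P] to [Q]. *)
Lemma mfilterM P Q f g :
  (forall u v, v \in msupp g -> P (u + v)%MM = Q u) ->
  mfilter P (f * g) = mfilter Q f * g.
Proof.
move=> PQ; rewrite [f]mpolyE mulr_suml !raddf_sum mulr_suml /=.
apply: eq_bigr => u _; rewrite [in LHS](mpolyE g) [in RHS](mpolyE g).
rewrite !mulr_sumr raddf_sum; apply: eq_big_seq => v v_g /=.
rewrite -scalerAl -scalerAr -mpolyXD !linearZ /= !mfilterX PQ //.
by case: ifP => _; rewrite ?scaler0 ?mul0r // mpolyXD scalerAr -scalerAl -scalerAr.
Qed.

Lemma mfilterM0 P f g : (forall u v, v \in msupp g -> P (u + v)%MM = false) ->
  mfilter P (f * g) = 0.
Proof.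
move=> PF; rewrite (@mfilterM P pred0) // mfilter_eq0 ?mul0r //.
Qed.

Lemma mfilter_split (T : eqType) (w : 'X_{1..m} -> T) f :
  f = \sum_(t <- undup (map w (msupp f))) mfilter (fun u => w u == t) f.
Proof.
apply/mpolyP => u; rewrite raddf_sum /=.
have [u_f|u_f] := boolP (u \in msupp f); last first.
  rewrite (memN_msupp_eq0 u_f) big1 // => t _.
  by rewrite mcoeff_mfilter (memN_msupp_eq0 u_f) if_same.
rewrite (bigD1_seq (w u)) ?undup_uniq ?mem_undup ?map_f //=.
rewrite mcoeff_mfilter eqxx big1 ?addr0 // => t /negPf.
by rewrite mcoeff_mfilter eq_sym => ->.
Qed.

End MonomialFilter.

(** * The Koszul complex *)

(* A function on the subsets of 'I_m stands for the form whose coefficient on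
   dx_(i_1) /\ ... /\ dx_(i_p), where i_1 < ... < i_p, is its value at
   [set i_1; ...; i_p]. *)
Notation extform m M := {ffun {set 'I_m} -> M}.

Section Koszul.
Variables (R : comNzRingType) (m : nat) (x : 'I_m -> R).
Implicit Types (i j : 'I_m) (A : {set 'I_m}).

(** For [i] outside [A], the sign that sorts dx_i /\ dx_A increasingly. *)
Definition ksign i A : R := (-1) ^+ #|[set j in A | (j < i)%N]|.

Lemma ksignU1 i j A : j \notin A ->
  ksign i (j |: A) = (-1) ^+ (j < i)%N * ksign i A.
Proof.
move=> jA; rewrite /ksign -exprD; congr (_ ^+ _).
have [ji|ji] := boolP (j < i)%N.
  have <- : #|j |: [set k in A | (k < i)%N]| = (1 + #|[set k in A | (k < i)%N]|)%N.
    by rewrite cardsU1 inE (negPf jA).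
  by apply: eq_card => k; rewrite !inE; have [->|] := eqVneq k j; rewrite ?ji.
apply: eq_card => k; rewrite !inE; have [->|] := eqVneq k j => //=.
by rewrite (negPf ji) andbF.
Qed.

Lemma ksignK i A : ksign i A * ksign i A = 1.
Proof. by rewrite /ksign -expr2 sqrr_sign. Qed.

Lemma ksignU1_self i A : ksign i (i |: A) = ksign i A.
Proof.
congr (_ ^+ _); apply: eq_card => k; rewrite !inE.
by have [->|] := eqVneq k i => //=; rewrite ltnn andbF.
Qed.

Lemma ksign_swap i j A : i != j -> i \notin A -> j \notin A ->
  ksign i A * ksign j (i |: A) = - (ksign j A * ksign i (j |: A)).
Proof.
move=> ij iA jA; rewrite !ksignU1 //.
have [_|_|/val_inj eq_ij] := ltngtP i j; last by rewrite eq_ij eqxx in ij.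
  by rewrite expr0 expr1; ring.
by rewrite expr0 expr1; ring.
Qed.

Lemma ksignU1M i j A : i != j -> i \notin A -> j \notin A ->
  ksign i (j |: A) * ksign j (i |: A) = - (ksign j A * ksign i A).
Proof.
move=> ij iA jA; rewrite !ksignU1 //.
have [_|_|/val_inj eq_ij] := ltngtP i j; last by rewrite eq_ij eqxx in ij.
  by rewrite expr0 expr1; ring.
by rewrite expr0 expr1; ring.
Qed.

Section Differential.
Variable M : lmodType R.
Implicit Types w : extform m M.

(** The Koszul differential, contraction by dx_i |-> x_i, read off at dx_A: only the forms dx_i /\
    dx_A with [i] outside [A] contribute. *)
Definition kdiff w : extform m M :=
  [ffun A : {set 'I_m} => \sum_(i | i \notin A) (ksign i A * x i) *: w (i |: A)].

Lemma kdiff_is_linear : linear kdiff.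
Proof.
move=> c v w; apply/ffunP => A; rewrite !ffunE scaler_sumr -big_split /=.
apply: eq_bigr => i _; rewrite !ffunE scalerDr !scalerA; congr (_ *: _ + _).
by rewrite mulrC.
Qed.

HB.instance Definition _ :=
  GRing.isLinear.Build R (extform m M) (extform m M) _ kdiff kdiff_is_linear.

Lemma kdiffB v w : kdiff (v - w) = kdiff v - kdiff w.
Proof. exact: raddfB. Qed.

Lemma kdiffZ c w : kdiff (c *: w) = c *: kdiff w.
Proof. exact: linearZ. Qed.

Definition kwedge i w : extform m M :=
  [ffun A : {set 'I_m} => if i \in A then ksign i A *: w (A :\ i) else 0].

Lemma kwedge_is_linear i : linear (kwedge i).
Proof.
move=> c v w; apply/ffunP => A; rewrite !ffunE; case: ifP; rewrite ?scaler0 ?addr0 //.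
by rewrite scalerDr !scalerA mulrC.
Qed.

HB.instance Definition _ i :=
  GRing.isLinear.Build R (extform m M) (extform m M) _ (kwedge i) (kwedge_is_linear i).

(** Contracting [i] then [j] cancels contracting [j] then [i], by [ksign_swap]; the sum over pairs
    is split by their order and one half is reindexed by the swap. *)
Lemma kdiff_kdiff w : kdiff (kdiff w) = 0.
Proof.
apply/ffunP => A; rewrite !ffunE.
pose F i j := ksign i A * x i * (ksign j (i |: A) * x j) *: w (j |: (i |: A)).
have FN i j : i != j -> i \notin A -> j \notin A -> F j i = - F i j.
  move=> ij iA jA; rewrite /F setUCA -scaleNr; congr (_ *: _).
  rewrite mulrACA [in RHS]mulrACA (ksign_swap _ jA iA) 1?eq_sym // mulNr.
  by rewrite [x j * _]mulrC.
transitivity (\sum_(i | i \notin A) \sum_(j | j \notin A)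
                 (if i == j then 0 else F i j : M)).
  apply: eq_bigr => i iA; rewrite !ffunE scaler_sumr.
  rewrite [RHS]big_mkcond [LHS]big_mkcond; apply: eq_bigr => j _.
  rewrite !inE negb_or eq_sym scalerA.
  by case: eqVneq => //=; case: ifP.
rewrite pair_big_dep /=.
rewrite (bigID (fun p : 'I_m * 'I_m => (p.1 < p.2)%N)) /=.
rewrite [X in _ + X](reindex_inj (h := fun p : 'I_m * 'I_m => (p.2, p.1))) /=; last first.
  by move=> [a b] [c d] [-> ->].
rewrite [X in _ + X](bigID (fun p : 'I_m * 'I_m => p.1 == p.2)) /= [X in _ + (X + _)]big1 ?add0r.
  rewrite [X in _ + X](_ : _ = - \sum_(p : 'I_m * 'I_m |
      (p.1 \notin A) && (p.2 \notin A) && (p.1 < p.2)%N)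
    if p.1 == p.2 then 0 else F p.1 p.2).
    by rewrite subrr.
  rewrite -sumrN; apply: eq_big => [[i j]|[i j]] /=.
    rewrite -val_eqE; case: ltngtP; rewrite ?andbT ?andbF // => _.
    by rewrite andbC.
  move=> /andP[/andP[/andP[jA iA] _] ij]; rewrite eq_sym (negPf ij).
  by rewrite FN.
by move=> [i j] /= /andP[_ /eqP ->]; rewrite eqxx.
Qed.

(** The Leibniz rule. At a set without [i] only the contraction of dx_i survives; at a set
    containing [i] that term of [kdiff w] gives back [x i *: w] and the others change sign. *)
Lemma kdiff_kwedge i w : kdiff (kwedge i w) = x i *: w - kwedge i (kdiff w).
Proof.
apply/ffunP => A; rewrite !ffunE; have [iA|iA] := boolP (i \in A); last first.
  rewrite subr0 (bigD1 i) //= !ffunE setU11 setU1K // ksignU1_self.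
  rewrite scalerA mulrAC ksignK mul1r big1 ?addr0 // => j /andP[jA ji].
  by rewrite ffunE in_setU1 eq_sym (negPf ji) (negPf iA) scaler0.
set B := A :\ i; have iB : i \notin B by rewrite !inE eqxx.
have -> : A = i |: B by rewrite setD1K.
rewrite (bigD1 i iB) /= scalerDr !scalerA mulrA ksignU1_self ksignK mul1r.
rewrite opprD addNKr -scalerN -sumrN scaler_sumr.
apply: eq_big => [j|j jA].
  by rewrite !inE negb_or andbC.
have /andP[ji jB] : (j != i) && (j \notin B) by move: jA; rewrite !inE negb_or.
rewrite ffunE !inE eqxx orbT.
have -> : (j |: (i |: B)) :\ i = j |: B.
  apply/setP => k; rewrite !inE; have [->|//] := eqVneq k i.
  by rewrite /= eq_sym (negPf ji); move: iB; rewrite !inE eqxx => /=.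
rewrite setUCA ksignU1_self scalerN !scalerA -scaleNr; congr (_ *: _).
rewrite mulrAC [_ * ksign i _]mulrC ksignU1M 1?eq_sym // mulNr.
by rewrite [ksign i B * _]mulrA [ksign i B * _]mulrC.
Qed.

Lemma kdiff_kwedgeB c c' i j w :
  kdiff (c *: kwedge i w - c' *: kwedge j w) =
  (c * x i - c' * x j) *: w - (c *: kwedge i (kdiff w) - c' *: kwedge j (kdiff w)).
Proof.
by rewrite kdiffB !kdiffZ !kdiff_kwedge !scalerBr !scalerA scalerBl !opprD addrACA.
Qed.

Definition pform p w := forall A, #|A| != p -> w A = 0.

Lemma pform_kdiff p w : pform p.+1 w -> pform p (kdiff w).
Proof.
move=> wp A Ap; rewrite ffunE big1 // => i iA.
by rewrite wp ?scaler0 // cardsU1 iA.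
Qed.

Lemma pform_kwedge p i w : pform p w -> pform p.+1 (kwedge i w).
Proof.
move=> wp A Ap; rewrite ffunE; case: ifP => // iA.
by rewrite wp ?scaler0 //; move: Ap; rewrite (cardsD1 i) iA.
Qed.

(** The sequence [x] is weakly regular on [M]: the quotient of [M] by all the x_k may be zero. *)
Definition xregular :=
  forall (k : 'I_m) (b : M) (a : 'I_m -> M),
    x k *: b = \sum_(i < m | (i < k)%N) x i *: a i ->
    exists c : 'I_m -> M, b = \sum_(i < m | (i < k)%N) x i *: c i.

Definition below k w := forall A i, i \in A -> (k <= i)%N -> w A = 0.

(** Induction on the number of variables allowed. Write w = a + dx_k /\ b with [a], [b] free of
    dx_k; then d b = 0 and d a = - x_k b. If b = d c, then a + x_k c is a cycle in fewer variables,
    hence some d e, and w = d (e - dx_k /\ c). *)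
Lemma koszul_exact_below k p w : xregular -> (k <= m)%N ->
  below k w -> pform p.+1 w -> kdiff w = 0 ->
  exists v, [/\ below k v, pform p.+2 v & w = kdiff v].
Proof.
move=> xreg; elim: k p w => [|k IH] p w km wk wp dw.
  exists 0; split; [by move=> A i _ _; rewrite ffunE|by move=> A _; rewrite ffunE|].
  rewrite raddf0; apply/ffunP => A; rewrite ffunE.
  have [->|[i iA]] := set_0Vmem A; last by rewrite (wk A i).
  by rewrite wp ?cards0.
pose k' := Ordinal km.
pose a : extform m M := [ffun A : {set 'I_m} => if k' \in A then 0 else w A].
pose b : extform m M := [ffun A : {set 'I_m} => if k' \in A then 0 else ksign k' A *: w (k' |: A)].
have wab : w = a + kwedge k' b.
  apply/ffunP => A; rewrite !ffunE; case: ifP => kA; last by rewrite addr0.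
  rewrite add0r !inE eqxx /= setD1K // scalerA -[in ksign k' A](setD1K kA).
  by rewrite ksignU1_self ksignK scale1r.
have ak : below k a.
  move=> A i iA ki; rewrite ffunE; case: ifP => // kA.
  apply: (wk A i iA); rewrite ltn_neqAle ki andbT.
  by apply/eqP => E; move: iA; rewrite (_ : i = k') ?kA //; apply/val_inj.
have bk : below k b.
  move=> A i iA ki; rewrite ffunE; case: ifP => // kA.
  rewrite (wk _ i) ?scaler0 ?inE ?iA ?orbT // ltn_neqAle ki andbT.
  by apply/eqP => E; move: iA; rewrite (_ : i = k') ?kA //; apply/val_inj.
have bp : pform p b.
  move=> A Ap; rewrite ffunE; case: ifP => // kA.
  by rewrite wp ?scaler0 // cardsU1 kA.
have da0 A : k' \in A -> kdiff a A = 0.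
  move=> kA; rewrite ffunE big1 // => i iA.
  by rewrite ffunE !inE kA orbT scaler0.
have db0 A : k' \in A -> kdiff b A = 0.
  move=> kA; rewrite ffunE big1 // => i iA.
  by rewrite ffunE !inE kA orbT scaler0.
have dab : kdiff a + x k' *: b - kwedge k' (kdiff b) = 0.
  by rewrite -addrA -kdiff_kwedge -raddfD /= -wab.
have dabE A : kdiff a A + x k' *: b A - kwedge k' (kdiff b) A = 0.
  have := congr1 (fun f : extform m M => f A) dab.
  rewrite [LHS]ffunE [X in X + _]ffunE [X in _ + X + _]ffunE.
  have -> : (- kwedge k' (kdiff b)) A = - kwedge k' (kdiff b) A by exact: ffunE.
  by move=> ->; exact: ffunE.
(* Neither [kdiff a] nor [b] has a coefficient at a set containing [k'], so these sets isolate
   [kdiff b]. *)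
have db : kdiff b = 0.
  apply/ffunP => A; rewrite [RHS]ffunE; have [/db0//|kA] := boolP (k' \in A).
  have := dabE (k' |: A); rewrite da0 ?setU11 // [b _]ffunE [kwedge _ _ _]ffunE.
  rewrite setU11 add0r scaler0 sub0r => /eqP; rewrite oppr_eq0 setU1K //.
  move/eqP/(congr1 (fun u => ksign k' (k' |: A) *: u)).
  by rewrite scalerA ksignK scale1r scaler0.
have dax : kdiff a = - (x k' *: b).
  by move/eqP: dab; rewrite db raddf0 subr0 addr_eq0 => /eqP.
(* In positive degree this is the induction hypothesis. In degree 0, [dax] puts x_k b in the span of
   the earlier variables, and regularity applies. *)
have [c [ck cp bc]] : exists c, [/\ below k c, pform p.+1 c & b = kdiff c].
  case: p wp bp => [|p] wp bp; last exact: (IH p) (ltnW km) bk bp db.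
  have := congr1 (fun f : extform m M => f set0) dax; rewrite !ffunE inE => E.
  have [|c cE] := xreg k' (b set0) (fun i => - a [set i]).
    rewrite !ffunE inE; apply: oppr_inj; rewrite -E -sumrN.
    rewrite (eq_bigl xpredT); last by move=> i; rewrite inE.
    rewrite [RHS]big_mkcond; apply: eq_bigr => i _.
    rewrite setU0 /ksign (_ : #|_| = 0%N); last first.
      by apply: eq_card0 => j; rewrite !inE.
    rewrite expr0 mul1r scalerN opprK ltnNge; case: leqP => // ki.
    by rewrite (ak _ i) ?scaler0 ?inE.
  pose e : extform m M := [ffun A : {set 'I_m} =>
    \sum_(i < m | (i < k)%N) if A == [set i] then c i else 0].
  exists e; split.
  - move=> A i iA ki; rewrite ffunE big1 // => j jk; case: eqP => // AE.
    by move: iA ki; rewrite AE inE => /eqP ->; rewrite leqNgt jk.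
  - move=> A A1; rewrite ffunE big1 // => i _; case: eqP => // AE.
    by rewrite AE cards1 in A1.
  apply/ffunP => A; have [->|AN0] := eqVneq A set0; last first.
    rewrite bp ?cards_eq0 // ffunE big1 // => i iA; rewrite ffunE big1 ?scaler0 //.
    move=> j _; case: eqP => // AE; have /set0Pn[l lA] := AN0.
    have /set1P ij : i \in [set j] by rewrite -AE setU11.
    have /set1P lj : l \in [set j] by rewrite -AE inE lA orbT.
    by rewrite ij -lj lA in iA.
  rewrite cE ffunE big_mkcond [in RHS](eq_bigl xpredT); last by move=> i; rewrite inE.
  apply: eq_bigr => i _; rewrite setU0 /ksign (_ : #|_| = 0%N); last first.
    by apply: eq_card0 => j; rewrite !inE.
  rewrite expr0 mul1r ffunE; case: ifP => ik.
    rewrite (bigD1 i) //= eqxx big1 ?addr0 // => j /andP[_ ji].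
    by case: eqP => // /set1_inj ij; rewrite ij eqxx in ji.
  rewrite big1 ?scaler0 // => j jk; case: eqP => // /set1_inj ij.
  by rewrite ij jk in ik.
have acE A : (a + x k' *: c) A = a A + x k' *: c A.
  by rewrite ffunE [X in _ + X]ffunE.
have [e [ek ep de]] : exists e, [/\ below k e, pform p.+2 e & a + x k' *: c = kdiff e].
  apply: (IH p); rewrite ?(ltnW km) //.
    by move=> A i iA ki; rewrite acE (ak _ i) // (ck _ i) // scaler0 addr0.
    by move=> A Ap; rewrite acE cp // scaler0 addr0 ffunE wp // if_same.
  by rewrite raddfD /= linearZ /= -bc dax addNr.
exists (e - kwedge k' c); split; last first.
  by rewrite raddfB /= kdiff_kwedge -de -bc opprB addrACA subrr addr0.
  move=> A Ap; rewrite !ffunE ep // sub0r; case: ifP => kA; rewrite ?oppr0 //.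
  rewrite cp ?scaler0 ?oppr0 //.
  by move: Ap; rewrite (cardsD1 k') kA.
move=> A i iA ki; rewrite !ffunE (ek _ i) ?(ltnW ki) // sub0r.
case: ifP => kA; rewrite ?oppr0 // (ck _ i) ?scaler0 ?oppr0 ?(ltnW ki) //.
by rewrite !inE iA andbT; apply/eqP => ik; rewrite ik ltnn in ki.
Qed.
Lemma koszul_exact p w : xregular -> pform p.+1 w -> kdiff w = 0 ->
  exists2 v, pform p.+2 v & w = kdiff v.
Proof.
move=> xreg wp dw; have wm : below m w by move=> A i _; rewrite leqNgt ltn_ord.
by have [v [_ vp ->]] := koszul_exact_below xreg (leqnn m) wm wp dw; exists v.
Qed.

End Differential.

Definition form_map (M N : lmodType R) (h : M -> N) (w : extform m M) : extform m N :=
  [ffun A => h (w A)].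

Lemma kdiff_form_map (M N : lmodType R) (h : {linear M -> N}) w :
  kdiff (form_map h w) = form_map h (kdiff w).
Proof.
apply/ffunP => A; rewrite !ffunE raddf_sum; apply: eq_bigr => i _ /=.
by rewrite ffunE linearZ.
Qed.

End Koszul.

(** * Regularity of the variables on free modules *)

Section Variables.
Variables (K : fieldType) (m : nat).
Local Notation S := {mpoly K[m]}.

(** Each monomial is charged to one variable in [P] dividing it, chosen by [pick]. *)
Lemma mpoly_sum_vars (P : pred 'I_m) (f : S) :
  (forall u, u \in msupp f -> exists2 i, P i & u i != 0%N) ->
  exists c : 'I_m -> S, f = \sum_(i | P i) 'X_i * c i.
Proof.
move=> Pf; pose ix (u : 'X_{1..m}) := [pick i | P i && (u i != 0%N)].
exists (fun i => \sum_(u <- msupp f | ix u == Some i) f@_u *: 'X_[u - U_(i)]).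
rewrite {1}[f]mpolyE.
transitivity (\sum_(u <- msupp f) \sum_(i | P i && (ix u == Some i))
    'X_i * (f@_u *: 'X_[u - U_(i)])).
  apply: eq_big_seq => u /Pf[i0 Pi0 ui0].
  rewrite /ix; case: pickP => [i /andP[Pi ui]|/(_ i0)]; last by rewrite Pi0 ui0.
  rewrite (bigD1 i) ?Pi ?eqxx //= big1 ?addr0.
    rewrite -scalerAr -mpolyXD addmC submK //.
    by apply/mnm_lepP => j; rewrite mnm1E; case: eqP => // <-; rewrite lt0n.
  by move=> j /andP[/andP[_ /eqP[->]]]; rewrite eqxx.
rewrite (exchange_big_dep P) /= => [|u i _ /andP[]//].
apply: eq_bigr => i Pi; rewrite mulr_sumr; apply: eq_bigl => u.
by rewrite Pi.
Qed.

(** Multiplication by 'X_k preserves the monomials free of the earlier variables, and no such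
    monomial occurs in the right-hand side; so every monomial of [b] involves an earlier
    variable. *)
Lemma xregular_row q : xregular (fun i : 'I_m => 'X_i : S) 'rV[S]_q.
Proof.
move=> k b a E.
have /fin_all_exists[c cE] (l : 'I_q) : exists c : {ffun 'I_m -> S},
    b 0 l = \sum_(i < m | (i < k)%N) 'X_i * c i.
  have [c ->] : exists c : 'I_m -> S, b 0 l = \sum_(i < m | (i < k)%N) 'X_i * c i.
    apply: mpoly_sum_vars => u ub.
    pose P (v : 'X_{1..m}) := [forall i : 'I_m, (i < k)%N ==> (v i == 0%N)].
    have /eqP : mfilter P (b 0 l) * 'X_k = 0.
      rewrite -(@mfilterM _ _ P) => [|v w].
        move/matrixP/(_ 0 l): E; rewrite mxE summxE mulrC => ->.
        rewrite raddf_sum big1 // => i ik; rewrite mxE mulrC /= mfilterM0 // => v w.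
        rewrite msuppX inE => /eqP ->; apply/negbTE; apply/negP.
        by move/forallP/(_ i); rewrite ik mnmDE mnm1E eqxx addn1.
      rewrite msuppX inE => /eqP ->; apply: eq_forallb => i.
      rewrite mnmDE mnm1E; have [<-|_] := eqVneq k i; last by rewrite addn0.
      by rewrite ltnn.
    rewrite mulf_eq0 (negPf (_ : 'X_k != 0)) ?orbF; last first.
      by apply/eqP => /(congr1 (fun f : S => f@_U_(k)))/eqP; rewrite mcoeffX eqxx mcoeff0 oner_eq0.
    move=> /eqP Pb; have : u \notin msupp (mfilter P (b 0 l)) by rewrite Pb msupp0.
    rewrite mem_msupp_mfilter ub andbT negb_forall => /existsP[i].
    by rewrite negb_imply => /andP[ik ui]; exists i.
  by exists [ffun i => c i]; apply: eq_bigr => i _; rewrite ffunE.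
exists (fun i => \row_l c l i); apply/rowP => l; rewrite cE summxE.
by apply: eq_bigr => i _; rewrite !mxE.
Qed.

End Variables.

(** * Koszul cycles and free resolutions *)

Section ResolutionKoszul.
Variables (K : fieldType) (m : nat).
Local Notation S := {mpoly K[m]}.
Local Notation X := (fun i : 'I_m => 'X_i : S).
Variables (I : S -> Prop) (F : free_complex K m).
Hypothesis I_ideal : is_ideal I.
Hypothesis F_graded : graded_complex F.
Hypothesis F_resolves : resolves I F.

(* In the total degree D, each dx_i has degree 1. *)
Definition bicomponent p D q (w : extform m 'rV[S]_(rk F q)) :
    extform m 'rV[S]_(rk F q) :=
  [ffun A : {set 'I_m} => if #|A| == p then \row_k
     mfilter (fun u => mdeg u + shift k + p == D)%N (w A 0 k) else 0].

Lemma pform_bicomponent p D q (w : extform m 'rV[S]_(rk F q)) :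
  pform p (bicomponent p D w).
Proof. by move=> A /negPf Ap; rewrite ffunE Ap. Qed.

Lemma kdiff_bicomponent p D q (w : extform m 'rV[S]_(rk F q)) :
  kdiff X (bicomponent p.+1 D w) = bicomponent p D (kdiff X w).
Proof.
apply/ffunP => A; rewrite !ffunE; case: eqP => Ap; last first.
  rewrite big1 // => i iA; rewrite ffunE cardsU1 iA.
  by case: eqP => [[/Ap]|]; rewrite ?scaler0.
apply/rowP => k; rewrite !mxE !summxE raddf_sum; apply: eq_bigr => i iA.
rewrite ffunE cardsU1 iA Ap eqxx !mxE /=.
rewrite mulrC [in RHS]mulrC; apply/esym/mfilterM => u v vX.
have hX : ksign S i A * 'X_i \is 1.-homog.
  by rewrite rpredMsign dhomogX /= mdeg1.
by rewrite mdegD (dhomog_mf hX vX) /= addn1 addSn addnS.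
Qed.

(** The second differential, besides [kdiff], of the double complex of Koszul forms with values in
    [F]; the two commute, without sign. *)
Definition fdiff q (w : extform m 'rV[S]_(rk F q.+1)) :
    extform m 'rV[S]_(rk F q) :=
  form_map (mulmxr (diff F q)) w.

Lemma fdiffD q (v w : extform m 'rV[S]_(rk F q.+1)) :
  fdiff (v + w) = fdiff v + fdiff w.
Proof. by apply/ffunP => A; rewrite !ffunE raddfD. Qed.

Lemma kdiff_fdiff q (w : extform m 'rV[S]_(rk F q.+1)) :
  kdiff X (fdiff w) = fdiff (kdiff X w).
Proof. exact: (kdiff_form_map X (mulmxr (diff F q))). Qed.

Lemma fdiff_bicomponent p D q (w : extform m 'rV[S]_(rk F q.+1)) :
  fdiff (bicomponent p D w) = bicomponent p D (fdiff w).
Proof.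
apply/ffunP => A; rewrite !ffunE; case: eqP => Ap; last by rewrite /= mul0mx.
apply/rowP => l; rewrite !mxE raddf_sum; apply: eq_bigr => k _.
rewrite !mxE; apply/esym/mfilterM => u v vd.
by rewrite mdegD -(F_graded.1 _ _ _ _ vd) addnA.
Qed.

Lemma bicomponent_idem p D q (w : extform m 'rV[S]_(rk F q)) :
  bicomponent p D (bicomponent p D w) = bicomponent p D w.
Proof.
apply/ffunP => A; rewrite !ffunE; case: eqP => // _; apply/rowP => k.
rewrite !mxE; apply: mfilter_id => u.
by rewrite mem_msupp_mfilter => /andP[].
Qed.

Lemma form_lift q (w : extform m 'rV[S]_(rk F q)) :
  (forall A, exists u, w A = u *m diff F q) -> exists v, w = fdiff v.
Proof.
move=> /fin_all_exists[v vE]; exists [ffun A => v A].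
by apply/ffunP => A; rewrite !ffunE vE.
Qed.

Lemma fdiff_fdiff q (w : extform m 'rV[S]_(rk F q.+2)) :
  fdiff (fdiff w) = 0.
Proof.
apply/ffunP => A; rewrite !ffunE /=; have [_ _ ex] := F_resolves.
by apply/ex; exists (w A).
Qed.

(** Induction on the Koszul degree [p]: exactness of [F] moves the problem from (p + 1, q) to (p, q
    + 1), and exactness of the Koszul complex corrects the answer on the way back. *)
Lemma koszul_descent h D p q (w : extform m 'rV[S]_(rk F q)) :
  (forall k : 'I_(rk F h), (shift k < D)%N) -> (p + q)%N = h ->
  bicomponent p D w = w ->
  (exists w', kdiff X w = fdiff w') ->
  exists v v', pform p.+1 v /\ w = kdiff X v + fdiff v'.
Proof.
move=> ltD; elim: p q w => [|p IH] q w pq wp [w' dw].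
  (* Here q = h: the generators have degree below [D], so every coefficient of [w] has positive
     degree and lies in the ideal of the variables. *)
  have [c cE] : exists c : 'I_m -> 'rV[S]_(rk F q), w set0 = \sum_i 'X_i *: c i.
    have /fin_all_exists[c cE] (k : 'I_(rk F q)) : exists c : {ffun 'I_m -> S},
        w set0 0 k = \sum_i 'X_i * c i.
      have [|c ->] := @mpoly_sum_vars K m xpredT (w set0 0 k).
        move=> u; rewrite -wp ffunE cards0 eqxx mxE mem_msupp_mfilter addn0.
        case/andP => /eqP degu _; have : mdeg u != 0%N.
          move: k degu; rewrite add0n in pq; rewrite pq => k degu.
          by have := ltD k; lia.
        rewrite mdeg_eq0 => u0; have [i ui|u00] := pickP (fun i => u i != 0%N).
          by exists i.
        case/eqP: u0; apply/mnmP => i; rewrite mnm0E.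
        by have /negbFE/eqP := u00 i.
      by exists [ffun i => c i]; apply: eq_bigr => i _; rewrite ffunE.
    exists (fun i => \row_k c k i); apply/rowP => k; rewrite cE summxE.
    by apply: eq_bigr => i _; rewrite !mxE.
  pose v : extform m 'rV[S]_(rk F q) :=
    [ffun A : {set 'I_m} => \sum_i if A == [set i] then c i else 0].
  have v1 : pform 1 v.
    move=> A A1; rewrite ffunE big1 // => i _; case: eqP => // AE.
    by rewrite AE cards1 in A1.
  exists v, 0; split=> //.
  have -> : fdiff (0 : extform m 'rV[S]_(rk F q.+1)) = 0.
    by apply/ffunP => B; rewrite !ffunE /= mul0mx.
  rewrite addr0; apply/ffunP => A.
  have [->|A0] := eqVneq A set0.
    rewrite cE ffunE; under [RHS]eq_bigl do rewrite inE.
    apply: eq_bigr => i _; rewrite setU0 ffunE (bigD1 i) //= eqxx.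
    rewrite big1 ?addr0; last first.
      by move=> j ji; case: eqP => // /set1_inj ij; rewrite ij eqxx in ji.
    rewrite /ksign (_ : #|_| = 0%N) ?mul1r //.
    by apply: eq_card0 => j; rewrite !inE.
  rewrite -wp (pform_bicomponent D w) ?cards_eq0 //.
  by rewrite (pform_kdiff X v1) ?cards_eq0.
(* Passing to the component of total degree [D] restores the homogeneity that the induction
   hypothesis requires. *)
pose z := bicomponent p D w'.
have dz : kdiff X w = fdiff z.
  by rewrite fdiff_bicomponent -dw -kdiff_bicomponent wp.
have [v [v' [vp zE]]] : exists v v', pform p.+1 v /\ z = kdiff X v + fdiff v'.
  apply: IH; rewrite ?addnS -?pq ?addSn ?bicomponent_idem //.
  apply: form_lift => A; have [_ _ ex] := F_resolves; apply/ex.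
  have := congr1 (fun f : extform m _ => f A) (kdiff_fdiff z).
  by rewrite -dz kdiff_kdiff !ffunE.
have [||e ep eE] := @koszul_exact _ _ X _ p (w - fdiff v) (@xregular_row _ _ _).
- move=> A Ap; rewrite !ffunE vp // /= mul0mx subr0 -wp.
  exact: pform_bicomponent.
- by rewrite raddfB /= dz zE kdiff_fdiff fdiffD fdiff_fdiff addr0 subrr.
by exists e, v; split=> //; rewrite -eE subrK.
Qed.

(* A Koszul cycle modulo I of internal degree h + e represents a class of
   Tor_h(S/I, K), which vanishes when F_h is generated in lower degrees. *)
Theorem koszul_boundary h e (z : extform m S^o) :
  (forall f, I f -> I (mfilter (fun u => mdeg u == 0%N) f)) ->
  (forall k : 'I_(rk F h), (shift k < h + e)%N) ->
  pform h z -> (forall A, z A \is e.-homog) ->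
  (forall A, I (kdiff X z A)) ->
  exists w : extform m S^o, forall A, I (z A - kdiff X w A).
Proof.
move=> I_homog ltD zp ze zI; have [I0 ID IM] := I_ideal.
have [onto ker _] := F_resolves.
have [u0 u0E] := onto 1.
(* The part of total degree 0 of a lift of 1 is still a lift of 1, since the degree 0 part of an
   element of [I] is in [I]. *)
pose u : 'rV[S]_(rk F 0) :=
  \row_k mfilter (fun v => mdeg v + shift k == 0)%N (u0 0 k).
have uE : I ((u *m aug F) 0 0 - 1).
  have := I_homog _ u0E; rewrite raddfB /= [mfilter _ 1]mfilter_id; last first.
    by move=> v; rewrite -mpolyC1 msupp1 inE => /eqP ->; rewrite mdeg0.
  rewrite mxE raddf_sum mxE; congr (I (_ - _)).
  apply: eq_bigr => k _; rewrite mxE; apply: mfilterM => v v' /= v'a.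
  by rewrite mdegD (dhomog_mf (F_graded.2 k) v'a).
pose w : extform m 'rV[S]_(rk F 0) := [ffun A : {set 'I_m} => (z A : S) *: u].
have kw A : kdiff X w A = kdiff X z A *: u.
  rewrite !ffunE scaler_suml; apply: eq_bigr => i _.
  by rewrite ffunE scalerA.
have [v [v' [_ wE]]] : exists v v', pform h.+1 v /\ w = kdiff X v + fdiff v'.
  apply: (koszul_descent ltD); rewrite ?addn0 //.
    apply/ffunP => A; rewrite !ffunE; case: eqP => Ah; last first.
      by rewrite zp ?scale0r //; apply/eqP.
    apply/rowP => k; rewrite !mxE mulrC.
    rewrite (@mfilterM _ _ _ (fun t => mdeg t + shift k == 0)%N).
      congr (_ * _); apply: mfilter_id => t.
      by rewrite mem_msupp_mfilter => /andP[].
    move=> t t' /(dhomog_mf (ze A)) /= t'e; rewrite mdegD t'e.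
    by apply/eqP/eqP; lia.
  apply: form_lift => A; apply/ker; rewrite kw -scalemxAl mxE mulrC.
  exact: IM.
(* Applying the augmentation to the decomposition of z (x) u gives the boundary: [a] sends [u] to 1
   and the image of [fdiff] to 0, modulo [I]. *)
pose a (t : 'rV[S]_(rk F 0)) : S := (t *m aug F) 0 0.
have aZ c t : a (c *: t) = c * a t by rewrite /a -scalemxAl mxE.
have aD t t' : a (t + t') = a t + a t' by rewrite /a mulmxDl mxE.
pose av : extform m S^o := [ffun A : {set 'I_m} => (a (v A) : S^o)].
exists av => A.
have kav : kdiff X av A = a (kdiff X v A).
  rewrite !ffunE.
  have -> : a (\sum_(i | i \notin A) (ksign S i A * 'X_i) *: v (i |: A)) =
    \sum_(i | i \notin A) a ((ksign S i A * 'X_i) *: v (i |: A)).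
    apply: (big_morph a aD); by rewrite /a mul0mx mxE.
  by apply: eq_bigr => i _; rewrite ffunE aZ.
have := congr1 (fun f : extform m _ => a (f A)) wE.
rewrite /= [X in _ = a X]ffunE aD -kav => aw.
have Ifd : I (a (fdiff v' A)) by apply/ker; exists (v' A); rewrite ffunE.
have -> : z A - kdiff X av A =
    a (fdiff v' A) + (- z A) * (a u - 1).
  have -> : a (fdiff v' A) = z A * a u - kdiff X av A.
    by move: aw; rewrite ffunE aZ => ->; rewrite addrC addKr.
  by rewrite mulNr mulrBr mulr1 opprB [RHS]addrC addrA subrK.
by apply: ID => //; apply: IM.
Qed.

End ResolutionKoszul.

(** * Binomial edge ideals *)

Section IdealLemmas.
Variable R : comNzRingType.
Implicit Types (I A : R -> Prop) (f g : R).

Lemma ideal_sum I (T : eqType) (s : seq T) (F : T -> R) : is_ideal I ->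
  (forall t, t \in s -> I (F t)) -> I (\sum_(t <- s) F t).
Proof.
by move=> [I0 ID _] IF; rewrite big_seq; elim/big_ind: _.
Qed.

Lemma idealN I f : is_ideal I -> I f -> I (- f).
Proof. by move=> [_ _ IM] If; rewrite -mulN1r; apply: IM. Qed.

Lemma idealB I f g : is_ideal I -> I f -> I g -> I (f - g).
Proof. by move=> Ii If Ig; have [_ ID _] := Ii; apply: ID => //; apply: idealN. Qed.

Lemma ideal_gen_ideal A : is_ideal (ideal_gen A).
Proof.
split.
- by exists [::]; rewrite big_nil.
- move=> f g [s [sA ->]] [s' [s'A ->]]; exists (s ++ s'); rewrite big_cat.
  by split=> // p; rewrite mem_cat => /orP[/sA|/s'A].
- move=> a f [s [sA ->]]; exists [seq (a * p.1, p.2) | p <- s]; split.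
    by move=> p /mapP[q /sA qA ->].
  by rewrite big_map mulr_sumr; apply: eq_bigr => p _; rewrite mulrA.
Qed.

Lemma ideal_gen_mem A f : A f -> ideal_gen A f.
Proof.
move=> Af; exists [:: (1, f)]; rewrite big_seq1 mul1r; split=> // p.
by rewrite inE => /eqP ->.
Qed.

Lemma ideal_gen_sub A I f : is_ideal I -> (forall g, A g -> I g) ->
  ideal_gen A f -> I f.
Proof.
move=> Ii AI [s [sA ->]]; apply: ideal_sum => // p /sA /AI.
by have [_ _] := Ii; apply.
Qed.

End IdealLemmas.

Lemma ideal_gen_mfilter (K : comNzRingType) (m : nat)
    (A I : {mpoly K[m]} -> Prop) P f :
  is_ideal I -> (forall a g, A g -> I (mfilter P (a * g))) ->
  ideal_gen A f -> I (mfilter P f).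
Proof.
move=> Ii AI [s [sA ->]]; rewrite raddf_sum; apply: ideal_sum => //= p /sA.
exact: AI.
Qed.

Section BinomialEdgeIdeal.
Variables (K : fieldType) (n : nat).
Local Notation S := {mpoly K[n + n]}.
Local Notation J := (@binomial_edge_ideal n K).
Local Notation x := (@lshift n n).
Local Notation y := (@rshift n n).
Implicit Types (e : rel 'I_n) (i j v w : 'I_n) (u : 'X_{1..n + n}) (f g : S).

Definition edge_poly i j : S := xvar K i * yvar K j - xvar K j * yvar K i.

Lemma edge_polyE i j :
  edge_poly i j = 'X_[U_(x i) + U_(y j)] - 'X_[U_(x j) + U_(y i)].
Proof. by rewrite !mpolyXD. Qed.

Lemma edge_polyN i j : edge_poly j i = - edge_poly i j.
Proof. by rewrite /edge_poly opprB. Qed.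

Lemma mem_msupp_edge_poly i j u : u \in msupp (edge_poly i j) ->
  u = (U_(x i) + U_(y j))%MM \/ u = (U_(x j) + U_(y i))%MM.
Proof.
rewrite edge_polyE => /msuppB_le; rewrite mem_cat !msuppX !inE.
by case/orP => /eqP ->; [left|right].
Qed.

Lemma bei_ideal e : is_ideal (J e).
Proof. exact: ideal_gen_ideal. Qed.

Lemma bei_edge e i j : ssrbool.symmetric e -> e i j -> J e (edge_poly i j).
Proof.
move=> esym eij; have [ij|ji|/val_inj ->] := ltngtP i j.
- by apply: ideal_gen_mem; exists i, j.
- rewrite edge_polyN; apply: (idealN (bei_ideal e)).
  by apply: ideal_gen_mem; exists j, i; split=> //; rewrite esym.
- by rewrite /edge_poly subrr; have [] := bei_ideal e.
Qed.

Lemma bei_sub e (I : S -> Prop) f : is_ideal I ->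
  (forall i j, e i j -> I (edge_poly i j)) -> J e f -> I f.
Proof. by move=> Ii eI; apply: ideal_gen_sub => // g [i [j [_ /eI]]] + ->. Qed.

Lemma bei_subrel e e' f : ssrbool.symmetric e' -> subrel e e' -> J e f -> J e' f.
Proof.
move=> e's ee'; apply: bei_sub (bei_ideal e') _ => i j /ee'; exact: bei_edge.
Qed.

Definition multideg u : 'X_{1..n} := [multinom u (x v) + u (y v) | v < n]%N.

Definition vsupp u : {set 'I_n} := [set v | multideg u v != 0%N].

Lemma multidegD u u' : multideg (u + u') = (multideg u + multideg u')%MM.
Proof. by apply/mnmP => v; rewrite !mnmE addnACA. Qed.

Lemma vsuppD u u' : vsupp (u + u') = vsupp u :|: vsupp u'.
Proof. by apply/setP => v; rewrite !inE multidegD mnmDE addn_eq0 negb_and. Qed.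

Lemma multideg_x v : multideg U_(x v) = U_(v)%MM.
Proof.
apply/mnmP => w; rewrite mnmE !mnm1E eq_lrshift addn0.
by rewrite (inj_eq (@lshift_inj _ _)).
Qed.

Lemma multideg_y v : multideg U_(y v) = U_(v)%MM.
Proof.
apply/mnmP => w; rewrite mnmE !mnm1E eq_rlshift add0n.
by rewrite (inj_eq (@rshift_inj _ _)).
Qed.

Lemma mdeg_multideg u : mdeg (multideg u) = mdeg u.
Proof.
rewrite !mdegE big_split_ord /= -big_split; apply: eq_bigr => v _.
by rewrite mnmE.
Qed.

Lemma multideg_edge i j u : u \in msupp (edge_poly i j) ->
  multideg u = (U_(i) + U_(j))%MM.
Proof.
case/mem_msupp_edge_poly => ->; rewrite multidegD multideg_x multideg_y //.
by rewrite addmC.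
Qed.

Lemma mfilter_multideg_edge (P : pred 'X_{1..n}) f i j :
  mfilter (fun u => P (multideg u)) (f * edge_poly i j) =
  mfilter (fun u => P (multideg u + (U_(i) + U_(j)))%MM) f * edge_poly i j.
Proof. by apply: mfilterM => u v /multideg_edge vE; rewrite multidegD vE. Qed.

Lemma bei_mfilter e (P : pred 'X_{1..n}) f :
  J e f -> J e (mfilter (fun u => P (multideg u)) f).
Proof.
apply: ideal_gen_mfilter (bei_ideal e) _ => a g [i [j [ij eij ->]]].
rewrite -/(edge_poly i j) mfilter_multideg_edge.
by have [_ _] := bei_ideal e; apply; apply: ideal_gen_mem; exists i, j.
Qed.

(** A multiple of an edge binomial keeps its factor when both ends are in [E]; otherwise none of its
    monomials is supported in [E]. *)
Lemma bei_restrict e (E : {set 'I_n}) f : J e f ->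
  J (induced e E) (mfilter (fun u => vsupp u \subset E) f).
Proof.
apply: ideal_gen_mfilter (bei_ideal _) _ => a g [i [j [ij eij ->]]].
rewrite -/(edge_poly i j).
have vsuppe u : u \in msupp (edge_poly i j) -> vsupp u = [set i; j].
  move=> /multideg_edge uE; apply/setP => v; rewrite !inE uE mnmDE !mnm1E.
  by rewrite addn_eq0 negb_and !eqb0 !negbK ![v == _]eq_sym.
have [ijE|ijE] := boolP ([set i; j] \subset E).
  rewrite (@mfilterM _ _ _ (fun u => vsupp u \subset E)); last first.
    by move=> u u' /vsuppe u'E; rewrite vsuppD subUset u'E ijE andbT.
  have [_ _] := bei_ideal (induced e E); apply; apply: ideal_gen_mem.
  exists i, j; split=> //; move: ijE; rewrite subUset !sub1set.
  by case/andP=> iE jE; apply/and3P.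
rewrite mfilterM0 => [|u u' /vsuppe u'E]; first by have [] := bei_ideal (induced e E).
by rewrite vsuppD subUset u'E (negPf ijE) andbF.
Qed.

End BinomialEdgeIdeal.

Lemma ltn_sum (I : finType) (P : pred I) (F G : I -> nat) i0 :
  P i0 -> (F i0 < G i0)%N -> (forall i, P i -> F i <= G i)%N ->
  (\sum_(i | P i) F i < \sum_(i | P i) G i)%N.
Proof.
move=> Pi0 FG0 FG; rewrite (bigD1 i0) //= [X in (_ < X)%N](bigD1 i0) //=.
by rewrite -addSn leq_add // leq_sum // => i /andP[/FG].
Qed.

(** * Monomial substitutions and membership in binomial edge ideals *)

Section Membership.
Variables (K : fieldType) (n : nat).
Local Notation S := {mpoly K[n + n]}.
Local Notation J := (@binomial_edge_ideal n K).
Local Notation x := (@lshift n n).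
Local Notation y := (@rshift n n).
Implicit Types (e : rel 'I_n) (i j v w : 'I_n) (u : 'X_{1..n + n}) (f g : S).
Implicit Types r : 'I_n -> 'I_n.

(* The substitution x_v |-> x_v, y_v |-> x_v * y_(r v): when the values of r
   label the connected components of a graph, its kernel is the ideal
   generated by the binomials of the pairs in a common component. *)
Definition glue r f : S :=
  f \mPo [tuple match split k with
                | inl v => xvar K v
                | inr v => xvar K v * yvar K (r v)
                end | k < n + n].

HB.instance Definition _ r := GRing.RMorphism.copy (glue r)
  (comp_mpoly [tuple match split k with
                | inl v => xvar K v
                | inr v => xvar K v * yvar K (r v)
                end | k < n + n]).

Definition glue_mnm r u : 'X_{1..n + n} :=
  (\sum_v (U_(x v) *+ u (x v) + (U_(x v) + U_(y (r v))) *+ u (y v)))%MM.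

Lemma glueX r u : glue r 'X_[u] = 'X_[glue_mnm r u].
Proof.
rewrite /glue comp_mpolyX big_split_ord /= /glue_mnm -mprodXE.
under [RHS]eq_bigr do rewrite mpolyXD -!mpolyXn mpolyXD.
rewrite big_split /=; congr (_ * _); apply: eq_bigr => v _; rewrite tnth_mktuple.
  by rewrite -/(unsplit (inl v)) unsplitK.
by rewrite -/(unsplit (inr v)) unsplitK.
Qed.

Lemma mcoeff_glue r f (k : 'X_{1..n + n}) :
  (glue r f)@_k = \sum_(u <- msupp f | glue_mnm r u == k) f@_u.
Proof.
rewrite /glue comp_mpolyEX raddf_sum [RHS]big_mkcond /=.
apply: eq_bigr => u _; rewrite -/(glue r 'X_[u]) glueX mcoeffZ mcoeffX.
by case: eqP; rewrite ?mulr1 ?mulr0.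
Qed.

(** With [glue_mnm_x], this shows that two monomials have the same image exactly when they share the
    multidegree and the total y-degree over each fibre of [r]. *)
Lemma glue_mnm_y r u w :
  glue_mnm r u (y w) = (\sum_(v | r v == w) u (y v))%N.
Proof.
rewrite /glue_mnm mnm_sumE [RHS]big_mkcond; apply: eq_bigr => v _.
rewrite mnmDE !mulmnE mnmDE !mnm1E eq_lrshift (inj_eq (@rshift_inj _ _)).
by case: eqP; rewrite /= ?mul0n ?mul1n.
Qed.

Lemma glue_mnm_x r u w : glue_mnm r u (x w) = multideg u w.
Proof.
rewrite /glue_mnm mnm_sumE mnmE (bigD1 w) //= big1 ?addn0 => [|v vw].
  by rewrite mnmDE !mulmnE mnmDE !mnm1E eq_rlshift eqxx mul1n addn0 mul1n.
rewrite mnmDE !mulmnE mnmDE !mnm1E eq_rlshift (inj_eq (@lshift_inj _ _)).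
by rewrite (negPf vw).
Qed.

Lemma glue_edge r i j : glue r (edge_poly K i j) =
  xvar K i * xvar K j * (yvar K (r j) - yvar K (r i)).
Proof.
have mx v : glue r (xvar K v) = xvar K v.
  rewrite /glue comp_mpolyXU -tnth_nth tnth_mktuple.
  by rewrite -/(unsplit (inl v)) unsplitK.
have my v : glue r (yvar K v) = xvar K v * yvar K (r v).
  rewrite /glue comp_mpolyXU -tnth_nth tnth_mktuple.
  by rewrite -/(unsplit (inr v)) unsplitK.
by rewrite rmorphB !rmorphM /= !mx !my; ring.
Qed.

Lemma mpolyX_neq0 (m : nat) (u : 'X_{1..m}) : 'X_[u] != 0 :> {mpoly K[m]}.
Proof. by rewrite -msupp_eq0 msuppX. Qed.

Lemma glue_edge_eq0 r i j : (glue r (edge_poly K i j) == 0) = (r i == r j).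
Proof.
rewrite glue_edge !mulf_eq0 !(negPf (mpolyX_neq0 _)) /= subr_eq0.
have [->|rij] := eqVneq (r i) (r j); first by rewrite eqxx.
apply/negP => /eqP/(congr1 (fun f : S => f@_U_(y (r j)))) /eqP.
rewrite !mcoeffX eqxx eq_mnm1 (inj_eq (@rshift_inj _ _)) (negPf rij).
by rewrite oner_eq0.
Qed.

Lemma glue_bei e r f : (forall i j, e i j -> r i = r j) -> J e f ->
  glue r f = 0.
Proof.
move=> er; apply: (@bei_sub _ _ e (fun f => glue r f = 0)) => [|i j eij].
  split=> [|a b a0 b0|a b b0]; first by rewrite raddf0.
    by rewrite raddfD /= a0 b0 addr0.
  by rewrite rmorphM /= b0 mulr0.
by apply/eqP; rewrite glue_edge_eq0 (er _ _ eij).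
Qed.

Lemma vsupp_xD u v : v \in vsupp (U_(x v) + u).
Proof. by rewrite inE multidegD multideg_x mnmDE mnm1E eqxx. Qed.

(* The monomial provides the interior vertices of a path from v to w. *)
Lemma bei_path e v w p u : ssrbool.symmetric e ->
  path e v (rcons p w) -> uniq p -> {subset p <= vsupp u} ->
  J e ('X_[u] * edge_poly K v w).
Proof.
move=> esym; have [J0 JD JM] := bei_ideal K e.
elim: p v u => [|z p IH] v u /=.
  by rewrite andbT => evw _ _; apply/JM/bei_edge.
case/andP=> evz pzw /andP[zp up] pu.
have step u' : {subset p <= vsupp u'} -> J e ('X_[u'] * edge_poly K z w).
  exact: IH.
have : z \in vsupp u by apply: pu; rewrite mem_head.
have sub (t : 'I_(n + n)) (u0 u1 : 'X_{1..n + n}) :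
    u = (U_(t) + u0)%MM -> multideg U_(t) = U_(z)%MM ->
    {subset p <= vsupp (u1 + u0)}.
  move=> uE tz a ap; have := pu a; rewrite inE ap orbT uE => /(_ isT).
  rewrite !inE !multidegD tz !mnmDE mnm1E.
  have /negPf -> : z != a by apply: contraNneq zp => ->.
  by rewrite add0n addn_eq0 => /negPf ->; rewrite andbF.
rewrite inE mnmE addn_eq0 negb_and => /orP[xz|yz].
  have uE : u = (U_(x z) + (u - U_(x z)))%MM.
    by rewrite addmC submK // lep1mP.
  rewrite uE mpolyXD.
  (* The three-term relation x_z f_vw = x_v f_zw + x_w f_vz spends the variable at [z] to shorten
     the path; the case of y_z below is the same. *)
  have -> : 'X_(x z) * 'X_[u - U_(x z)] * edge_poly K v w =
      'X_[U_(x v) + (u - U_(x z))] * edge_poly K z w +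
      'X_[U_(x w) + (u - U_(x z))] * edge_poly K v z.
    by rewrite !mpolyXD /edge_poly /xvar /yvar; ring.
  apply: JD; last by apply/JM/bei_edge.
  by apply: step; apply: sub uE _; rewrite multideg_x.
have uE : u = (U_(y z) + (u - U_(y z)))%MM.
  by rewrite addmC submK // lep1mP.
rewrite uE mpolyXD.
have -> : 'X_(y z) * 'X_[u - U_(y z)] * edge_poly K v w =
    'X_[U_(y v) + (u - U_(y z))] * edge_poly K z w +
    'X_[U_(y w) + (u - U_(y z))] * edge_poly K v z.
  by rewrite !mpolyXD /edge_poly /xvar /yvar; ring.
apply: JD; last by apply/JM/bei_edge.
by apply: step; apply: sub uE _; rewrite multideg_y.
Qed.

Lemma path_induced e (E : {set 'I_n}) v p :
  path (induced e E) v p -> {subset p <= E}.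
Proof.
elim: p v => // z p IH v /= /andP[/and3P[_ zE _] /IH pE] a.
by rewrite inE => /predU1P[->|/pE].
Qed.

Lemma bei_connect e (E : {set 'I_n}) v w u : ssrbool.symmetric e ->
  {in E, forall z, z != v -> z != w -> z \in vsupp u} ->
  connect (induced e E) v w -> J e ('X_[u] * edge_poly K v w).
Proof.
move=> esym Eu /connectP[p0 p0e wE]; rewrite wE in Eu *.
case/shortenP: p0e Eu => p pe uvp _ Eu.
case: (lastP p) pe uvp Eu => [|{}p z] pe uvp Eu.
  by rewrite /= /edge_poly subrr mulr0; have [] := bei_ideal K e.
rewrite last_rcons in Eu *.
have /andP[] : (v \notin rcons p z) && uniq (rcons p z) by [].
rewrite mem_rcons inE negb_or rcons_uniq => /andP[_ vp] /andP[zp up].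
apply: bei_path esym _ up _; first by apply: sub_path pe => a b /and3P[].
move=> a ap; apply: Eu.
- by apply: (path_induced pe); rewrite mem_rcons inE ap orbT.
- by apply: contraNneq vp => <-.
- by apply: contraNneq zp => <-.
Qed.

(** While the monomials differ, some [w] lacks y-degree and some [v] in the same fibre has too much.
    Replacing x_w y_v by x_v y_w changes 'X_[u] by a multiple of an edge binomial that [bei_connect]
    puts in J, and keeps the multidegree. *)
Lemma bei_exchange e r u u' : ssrbool.symmetric e ->
  glue_mnm r u = glue_mnm r u' ->
  {in vsupp u &, forall v w, r v = r w -> connect (induced e (vsupp u)) v w} ->
  J e ('X_[u] - 'X_[u']).
Proof.
(* The subtraction is truncated: the measure counts only the missing y-degree, and each exchange
   lowers it. *)
move=> esym; have [k] := ubnP (\sum_v (u' (y v) - u (y v)))%N.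
elim: k u => // k IH u; rewrite ltnS => uk uu' conn.
have mE v : multideg u v = multideg u' v by rewrite -!(glue_mnm_x r) uu'.
have yE w : (\sum_(v | r v == w) u (y v) = \sum_(v | r v == w) u' (y v))%N.
  by rewrite -!glue_mnm_y uu'.
have [w wlt|ge_u] := pickP (fun w => (u (y w) < u' (y w))%N); last first.
  suff -> : u = u' by rewrite subrr; have [] := bei_ideal K e.
  have yu v : u (y v) = u' (y v).
    apply/eqP; rewrite eqn_leq [X in _ && X]leqNgt ltnNge.
    have /negbT := ge_u v; rewrite -leqNgt => -> /=; rewrite andbT leqNgt.
    apply/negP => lt; have := yE (r v); apply/eqP; rewrite neq_ltn orbC.
    rewrite (@ltn_sum _ _ _ _ v) // => z _.
    by have /negbT := ge_u z; rewrite -leqNgt.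
  apply/mnmP => t; rewrite -(splitK t); case: (split t) => v /=; last exact: yu.
  by have := mE v; rewrite !mnmE yu => /addIn.
have [v /andP[/eqP rvw vlt]|le_u] :=
    pickP (fun v => (r v == r w) && (u' (y v) < u (y v)))%N; last first.
  have := yE (r w); move/eqP; rewrite eqn_leq => /andP[_]; rewrite leqNgt.
  rewrite (@ltn_sum _ _ _ _ w) // => z rz.
  by have := le_u z; rewrite rz /= => /negbT; rewrite -leqNgt.
have vw : v != w by apply/eqP => E; move: vlt wlt; rewrite E; lia.
have uyv : (0 < u (y v))%N by lia.
have uxw : (0 < u (x w))%N by have := mE w; rewrite !mnmE; lia.
pose u0 := (u - (U_(y v) + U_(x w)))%MM.
have uE : u = (u0 + (U_(y v) + U_(x w)))%MM.
  rewrite submK //; apply/mnm_lepP => t; rewrite mnmDE !mnm1E.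
  have [<-|_] := eqVneq; have [t'|_] := eqVneq; rewrite ?addn0 ?add0n //.
  - by move/eqP: t'; rewrite eq_lrshift.
  - by rewrite -t'.
pose u1 := (u0 + (U_(x v) + U_(y w)))%MM.
have mu1 : multideg u1 = multideg u.
  by rewrite uE !multidegD !multideg_x !multideg_y.
have su1 : vsupp u1 = vsupp u by apply/setP => z; rewrite !inE mu1.
have -> : 'X_[u] - 'X_[u'] =
    'X_[u0] * edge_poly K w v + ('X_[u1] - 'X_[u']) :> S.
  by rewrite {1}uE /u1 !mpolyXD /edge_poly /xvar /yvar; ring.
have [_ JD _] := bei_ideal K e; apply: JD.
  apply: (bei_connect (E := vsupp u)) => //.
    move=> z; rewrite !inE {1}uE !multidegD multideg_x multideg_y !mnmDE !mnm1E.
    by move=> + zw zv; rewrite ![_ == z]eq_sym (negPf zw) (negPf zv) !addn0.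
  apply: conn; rewrite // inE mnmE; lia.
have u1y z : (u1 (y z) + (v == z) = u (y z) + (w == z))%N.
  rewrite [in RHS]uE /u1 !mnmDE !mnm1E !eq_lrshift !(inj_eq (@rshift_inj _ _)).
  by rewrite /= addn0 add0n addnAC.
apply: IH.
- apply: leq_trans uk; apply: (ltn_sum (i0 := w)) => // [|z _].
    by have := u1y w; rewrite eqxx (negPf vw); lia.
  have := u1y z; have [<-|_] := eqVneq v z; last by lia.
  by rewrite eq_sym (negPf vw); lia.
- rewrite -uu'; apply/mnmP => t; rewrite -(splitK t); case: (split t) => z /=.
    by rewrite !glue_mnm_x mu1.
  rewrite !glue_mnm_y.
  apply: (@addIn (\sum_(a | r a == z) (v == a))%N).
  rewrite -big_split /=; under eq_bigr do rewrite u1y.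
  rewrite big_split /=; congr (_ + _)%N.
  rewrite [LHS]big_mkcond [RHS]big_mkcond (bigD1 w) //= [RHS](bigD1 v) //= !eqxx rvw.
  congr (_ + _)%N; rewrite !big1 // => a; rewrite eq_sym => /negPf ->; exact: if_same.
- by rewrite su1.
Qed.

End Membership.

(** * Kernels of the substitutions and cancellation of edge binomials *)

Section Kernels.
Variables (K : fieldType) (n : nat).
Local Notation S := {mpoly K[n + n]}.
Local Notation J := (@binomial_edge_ideal n K).
Local Notation x := (@lshift n n).
Local Notation y := (@rshift n n).
Implicit Types (e : rel 'I_n) (i j v w : 'I_n) (u : 'X_{1..n + n}) (f g : S).
Implicit Types r : 'I_n -> 'I_n.

(** Group the monomials of [f] by their image. In each group the coefficients sum to 0, so the group
    is a combination of differences covered by [bei_exchange]. *)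
Lemma bei_kernel e r f : ssrbool.symmetric e ->
  (forall u, u \in msupp f ->
    {in vsupp u &, forall v w, r v = r w -> connect (induced e (vsupp u)) v w}) ->
  glue r f = 0 -> J e f.
Proof.
move=> esym conn rf0; rewrite (mfilter_split (glue_mnm r) f).
apply: ideal_sum (bei_ideal K e) _ => k.
rewrite mem_undup => /mapP[u0 u0f ->].
have c0 : \sum_(u <- msupp f | glue_mnm r u == glue_mnm r u0) f@_u = 0.
  by rewrite -mcoeff_glue rf0 mcoeff0.
have -> : mfilter (fun u => glue_mnm r u == glue_mnm r u0) f =
    \sum_(u <- msupp f | glue_mnm r u == glue_mnm r u0)
      (f@_u)%:MP * ('X_[u] - 'X_[u0]).
  under [RHS]eq_bigr do rewrite mulrBr mul_mpolyC.
  by rewrite sumrB -mulr_suml -raddf_sum /= c0 mpolyC0 mul0r subr0.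
have [J0 _ JM] := bei_ideal K e.
rewrite big_mkcond; apply: ideal_sum (bei_ideal K e) _ => u uf.
by case: eqP => // uE; apply/JM/(bei_exchange K esym uE)/conn.
Qed.

Lemma bei_complete_kernel (v0 : 'I_n) f :
  J (@complete_graph n) f <-> glue (fun=> v0) f = 0.
Proof.
split; first exact: glue_bei.
apply: bei_kernel => [i j|u _ v w vu wu _]; first by rewrite /complete_graph /= eq_sym.
have [->|vw] := eqVneq v w; first exact: connect0.
by apply/connect1/and3P.
Qed.

(** The ideal is the kernel of a ring morphism to a domain: [glue] with constant labels. *)
Lemma bei_complete_prime : (0 < n)%N -> prime_ideal (J (@complete_graph n)).
Proof.
move=> n0; have mE := bei_complete_kernel (Ordinal n0).
split; first exact: bei_ideal.
  by move/mE/eqP; rewrite rmorph1 oner_eq0.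
move=> f g /mE/eqP; rewrite rmorphM mulf_eq0.
by case/orP => /eqP /mE; [left|right].
Qed.

Lemma induced_sym e E : ssrbool.symmetric e -> ssrbool.symmetric (induced e E).
Proof. by move=> es i j; rewrite /induced /= es andbCA. Qed.

Lemma root_induced e E v w : ssrbool.symmetric e ->
  fingraph.root (induced e E) v = fingraph.root (induced e E) w <-> connect (induced e E) v w.
Proof.
move=> es; have cs := sym_connect_sym (induced_sym E es).
by split=> [/eqP|vw]; [|apply/eqP]; rewrite root_connect.
Qed.

(** Let [r] label the components of the graph induced on [E]. Then [glue r] kills the product but
    not the binomial, since [i] and [j] are in different components; so it kills [f], and
    [bei_kernel] applies because the vertices of [D] have the same components within [D] as within
    [E]. *)
Lemma bei_edge_cancel e (d : 'X_{1..n}) f i j : ssrbool.symmetric e ->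
  let D := [set v | d v != 0%N] in
  let E := D :|: [set i; j] in
  {in msupp f, forall u, multideg u = d} ->
  {in D &, forall v w, connect (induced e E) v w -> connect (induced e D) v w} ->
  J e (f * edge_poly K i j) ->
  ~~ connect (induced e E) i j -> J e f.
Proof.
move=> es D E fd DE Jf nij.
have uD u : u \in msupp f -> vsupp u = D.
  by move=> /fd ud; apply/setP => v; rewrite !inE ud.
have : J (induced e E) (f * edge_poly K i j).
  have := bei_restrict E Jf; rewrite mfilter_id // => u /msuppM_le.
  case/allpairsP => -[u1 u2] /= [/fd u1d /multideg_edge u2d ->].
  apply/subsetP => v; rewrite !inE multidegD u1d u2d !mnmDE !mnm1E.
  by rewrite ![v == _]eq_sym; case: (i == v); case: (j == v); case: (d v).
set r := fingraph.root (induced e E).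
have rE a b : induced e E a b -> r a = r b by move/connect1/(root_induced _ _ _ es).
move/(glue_bei rE)/eqP; rewrite rmorphM mulf_eq0 glue_edge_eq0 => /orP[/eqP rf0|]; last first.
  by move/eqP/(root_induced _ _ _ es); rewrite (negPf nij).
apply: (bei_kernel es) rf0 => u /uD -> v w vD wD /(root_induced _ _ _ es).
exact: DE.
Qed.

(** In each multidegree [bei_edge_cancel] applies: adding an isolated vertex and a vertex with at
    most one neighbour merges no components. *)
Lemma bei_leaf_regular e f v l : ssrbool.symmetric e -> v != l ->
  (forall z, ~~ e l z) -> (forall z z', e v z -> e v z' -> z = z') ->
  J e (f * edge_poly K v l) -> J e f.
Proof.
move=> es vl el ev Jf; rewrite (mfilter_split (@multideg n) f).
apply: ideal_sum (bei_ideal K e) _ => d _.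
have dJ : J e (mfilter (fun u => multideg u == d) f * edge_poly K v l).
  pose P (t : 'X_{1..n}) := (t == d + (U_(v) + U_(l)))%MM.
  have := bei_mfilter P Jf; rewrite (mfilter_multideg_edge P).
  congr (J e (_ * _)); apply/mpolyP => u.
  by rewrite !mcoeff_mfilter /P eqm_add2r.
apply: (bei_edge_cancel (d := d) es) dJ _.
- by move=> u; rewrite mem_msupp_mfilter => /andP[/eqP].
- set D := [set z | _] => a b aD bD.
  (* If [v] is outside [D], this collapses it to its neighbour, which turns walks in the larger set
     into walks in [D]. *)
  pose s z := if z \in D then z else odflt z [pick z' | e v z'].
  rewrite -[X in connect (induced e D) X _](_ : s a = a); last by rewrite /s aD.
  rewrite -[X in connect (induced e D) _ X](_ : s b = b); last by rewrite /s bD.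
  suff sP c c' : induced e (D :|: [set v; l]) c c' -> connect (induced e D) (s c) (s c').
    move=> /connectP[p + ->]; elim: p (a) => [|c p IH] a' /=; first by rewrite connect0.
    by case/andP=> /sP ac /IH; apply: connect_trans.
  have sv z : v \notin D -> e v z -> s v = z.
    move=> vD evz; rewrite /s (negPf vD); case: pickP => [z' /ev|/(_ z)]; first exact.
    by rewrite evz.
  have Ev z z' : z \in D :|: [set v; l] -> z \notin D -> e z z' -> z = v.
    rewrite !inE => /or3P[-> //|/eqP//|/eqP ->] _ lz.
    by have := el z'; rewrite lz.
  case/and3P=> cE c'E cc'.
  have [cD|cD] := boolP (c \in D); have [c'D|c'D] := boolP (c' \in D).
  + by apply: connect1; rewrite /s cD c'D; apply/and3P.
  + rewrite es in cc'; have c'v := Ev _ _ c'E c'D cc'; subst c'.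
    by rewrite (sv _ c'D cc') /s cD connect0.
  + have cv := Ev _ _ cE cD cc'; subst c.
    by rewrite (sv _ cD cc') /s c'D connect0.
  + have cv := Ev _ _ cE cD cc'; rewrite es in cc'.
    by rewrite cv (Ev _ _ c'E c'D cc') connect0.
- apply: contra vl => /connectP[p]; elim/last_ind: p => [_ -> //|p z _].
  rewrite rcons_path last_rcons => /andP[_ /and3P[_ _ zl]] lz.
  by have := el (last v p); rewrite es lz zl.
Qed.

End Kernels.

(** * Colon ideals *)

(** Excluded middle replaces the decidability of [P]. *)
Lemma ex_is_min (P : nat -> Prop) : (exists d, P d) -> exists d, is_min P d.
Proof.
case=> d; elim/ltn_ind: d => d IH Pd.
have [[k [kd Pk]]|no] := classic (exists k, (k < d)%N /\ P k); first exact: IH Pk.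
exists d; split=> // k Pk; rewrite leqNgt; apply/negP => kd; apply: no.
by exists k.
Qed.

Section ColonIdeals.
Variables (K : fieldType) (n : nat).
Local Notation S := {mpoly K[n + n]}.
Local Notation J := (@binomial_edge_ideal n K).
Local Notation JK := (J (@complete_graph n)).
Local Notation x := (@lshift n n).
Implicit Types (e : rel 'I_n) (i j v w : 'I_n) (u : 'X_{1..n + n}) (f g : S).
Implicit Types D E : {set 'I_n}.

Lemma connect_subset e D E v w : D \subset E ->
  connect (induced e D) v w -> connect (induced e E) v w.
Proof.
move=> DE; apply: connect_sub => {v w} v w /and3P[vD wD vw].
by apply/connect1/and3P; split=> //; apply: (subsetP DE).
Qed.

(** The colon is contained in J_K since J_K is a prime containing J_G and no monomial. Conversely,
    any two vertices are joined by a path with interior in [D], so [bei_connect] applies to their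
    binomial. *)
Lemma bei_colon_dominating e D : (0 < n)%N -> ssrbool.symmetric e ->
  connected_dominating e D ->
  same_ideal (colon (J e) (\prod_(v in D) xvar K v)) JK.
Proof.
move=> n0 es /andP[Dconn Ddom]; set f := \prod_(v in D) _.
have fE : f = 'X_[\sum_(v in D) U_(x v)] by rewrite -mprodXE.
have near i : exists2 i', i' \in D & connect (induced e (i |: D)) i i'.
  have [iD|iD] := boolP (i \in D); first by exists i.
  have := forallP Ddom i; rewrite inE iD => /existsP[i' /andP[i'D ii']].
  by exists i' => //; apply/connect1/and3P; rewrite !inE eqxx i'D orbT.
move=> g; split=> [gf|].
  have [_ _ /(_ f g)] := bei_complete_prime K n0; rewrite mulrC.
  case=> //.
    apply: bei_sub gf; first exact: bei_ideal.
    move=> i j eij; have [<-|ij] := eqVneq i j; last first.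
      by apply: bei_edge => // a b; rewrite /complete_graph /= eq_sym.
    by rewrite /edge_poly subrr; have [] := bei_ideal K (@complete_graph n).
  move/(bei_complete_kernel (Ordinal n0) _)/eqP.
  by rewrite fE glueX (negPf (mpolyX_neq0 _ _)).
apply: (@bei_sub _ _ _ (fun g => J e (g * f))) => [|i j ij].
  have [J0 JD JM] := bei_ideal K e; split; first by rewrite mul0r.
    by move=> a b Ja Jb; rewrite mulrDl; apply: JD.
  by move=> a b Jb; rewrite -mulrA; apply: JM.
rewrite mulrC fE; apply: (bei_connect K (E := D :|: [set i; j]) es).
  move=> z; rewrite !inE => /or3P[zD _ _|/eqP-> /eqP//|/eqP-> _ /eqP//].
  rewrite (bigD1 z) //=; have := vsupp_xD (\sum_(v in D | v != z) U_(x v))%MM z.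
  by rewrite inE.
have [i' i'D ii'] := near i; have [j' j'D jj'] := near j.
have cs := sym_connect_sym (induced_sym (D :|: [set i; j]) es).
apply: (connect_trans (y := i')).
  by apply: connect_subset ii'; rewrite setUC setUS // sub1set !inE eqxx.
apply: (connect_trans (y := j')).
  apply: (connect_subset (subsetUl D _)).
  by have /forall_inP/(_ i' i'D)/forall_inP/(_ j' j'D) := Dconn.
rewrite cs; apply: connect_subset jj'.
by rewrite setUC setUS // sub1set !inE eqxx orbT.
Qed.

Lemma dominating_of_colon e f k : simple_graph e -> ~~ is_complete e ->
  (0 < n)%N -> f \is k.-homog -> same_ideal (colon (J e) f) JK ->
  exists2 D, connected_dominating e D & (#|D| <= k)%N.
Proof.
move=> [es eirr] encomp n0 fk colonE.
have nJf : ~ J e f.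
  move=> Jf; have [_ JK1 _] := bei_complete_prime K n0; apply: JK1.
  by apply/colonE; rewrite /colon mul1r.
have [d nJd] : exists d, ~ J e (mfilter (fun u => multideg u == d) f).
  have [//|no] := classic (exists d, ~ J e (mfilter (fun u => multideg u == d) f)).
  case: nJf; rewrite (mfilter_split (@multideg n) f).
  apply: ideal_sum (bei_ideal K e) _ => d _.
  by have [//|nJ] := classic (J e (mfilter (fun u => multideg u == d) f)); case: no; exists d.
set g := mfilter _ f in nJd.
have gd : {in msupp g, forall u, multideg u = d}.
  by move=> u; rewrite mem_msupp_mfilter => /andP[/eqP].
have Jg i j : J e (g * edge_poly K i j).
  have [<-|ij] := eqVneq i j.
    by rewrite /edge_poly subrr mulr0; have [] := bei_ideal K e.
  have : J e (f * edge_poly K i j).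
    rewrite mulrC; apply/(colonE (edge_poly K i j))/bei_edge => //.
    by move=> a b; rewrite /complete_graph /= eq_sym.
  pose P (t : 'X_{1..n}) := (t == d + (U_(i) + U_(j)))%MM.
  move/(bei_mfilter P); rewrite (mfilter_multideg_edge P).
  congr (J e (_ * _)); apply/mpolyP => u.
  by rewrite !mcoeff_mfilter /P eqm_add2r.
set D := [set v | d v != 0%N].
(* The contrapositive of [bei_edge_cancel] for the component [g], which is not in J_G although its
   product with every binomial is. *)
have conn i j : {in D &, forall v w, connect (induced e (D :|: [set i; j])) v w ->
      connect (induced e D) v w} -> connect (induced e (D :|: [set i; j])) i j.
  by move=> DE; apply/negPn/negP => nij; apply/nJd/(bei_edge_cancel es gd DE (Jg i j)).
have Dconn : {in D &, forall v w, connect (induced e D) v w}.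
  move=> v w vD wD; have /setUidPl DE : [set v; w] \subset D.
    by rewrite subUset !sub1set vD wD.
  by have := @conn v w; rewrite DE; apply.
(* The first edge of a path from [i] to [j]. For [j] in [D] it gives domination; for [D] empty it
   makes all pairs adjacent. *)
have step i j : i != j -> exists2 z, z \in D :|: [set j] & e i z.
  move=> ij; have /connectP[p] : connect (induced e (D :|: [set i; j])) i j.
    by apply: conn => v w vD wD _; apply: Dconn.
  case: p => [_ ji|z p]; first by rewrite ji eqxx in ij.
  rewrite [path _ _ _]/= => /andP[/and3P[_ zE iz] _] _.
  exists z => //; move: zE; rewrite !inE => /or3P[->//|/eqP zi|->]; last by rewrite orbT.
  by rewrite zi eirr in iz.
have [D0|[j jD]] := set_0Vmem D.
  case/negP: encomp; apply/forallP => i; apply/forallP => j; apply/implyP => ij.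
  by have [z] := step i j ij; rewrite D0 set0U inE => /eqP ->.
exists D.
  apply/andP; split.
    by apply/forall_inP => v vD; apply/forall_inP => w wD; apply: Dconn.
  apply/forall_inP => i; rewrite inE => iD.
  have [|z] := step i j; first by apply: contraNneq iD => ->.
  rewrite !inE => /orP[zD iz|/eqP -> ij]; apply/existsP.
    by exists z; rewrite inE zD.
  by exists j; rewrite jD.
have [u ug] : exists u, u \in msupp g.
  case E : (msupp g) => [|u s]; last by exists u; rewrite mem_head.
  by case: nJd; rewrite (msuppnil0 E); have [] := bei_ideal K e.
have uf : u \in msupp f by move: ug; rewrite mem_msupp_mfilter => /andP[].
(* A monomial of [g] has total degree [k] and degree at least 1 at each vertex of [D]. *)
rewrite -(dhomog_mf fk uf) /= -mdeg_multideg (gd _ ug) mdegE -sum1_card.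
rewrite big_mkcond; apply: leq_sum => v _; rewrite inE.
by case: (d v).
Qed.

End ColonIdeals.

Lemma connected_dominationP n (e : rel 'I_n) : connected_graph e ->
  exists2 D : {set 'I_n}, connected_dominating e D &
    connected_domination_number e = #|D| /\
    forall E : {set 'I_n}, connected_dominating e E -> (#|D| <= #|E|)%N.
Proof.
move=> econn; rewrite /connected_domination_number; case: arg_minnP.
  apply/andP; split; last by apply/forall_inP => i; rewrite setCT inE.
  apply/forall_inP => i _; apply/forall_inP => j _.
  apply: connect_sub (econn i j) => a b ab; apply/connect1/and3P.
  by rewrite !inE.
by move=> D Dcd Dmin; exists D.
Qed.

(** * Koszul cycles of trees *)

Section TreeKoszulCycles.
Variables (K : fieldType) (n : nat).
Local Notation S := {mpoly K[n + n]}.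
Local Notation J := (@binomial_edge_ideal n K).
Local Notation x := (@lshift n n).
Local Notation y := (@rshift n n).
Local Notation X := (fun k : 'I_(n + n) => 'X_k : S).
Local Notation F := (extform (n + n) S^o).
Implicit Types (e t : rel 'I_n) (v l : 'I_n) (f g : S) (U : {set 'I_n}).
Implicit Types (k : 'I_(n + n)) (A : {set 'I_(n + n)}) (z w : F).

Definition vertex k : 'I_n := match split k with inl v => v | inr v => v end.

Lemma vertex_x v : vertex (x v) = v.
Proof. by rewrite /vertex -/(unsplit (inl v)) unsplitK. Qed.

Lemma vertex_y v : vertex (y v) = v.
Proof. by rewrite /vertex -/(unsplit (inr v)) unsplitK. Qed.

Lemma vsuppU k : vsupp U_(k) = [set vertex k].
Proof.
apply/setP => v; rewrite -(splitK k); case: (split k) => w /=.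
  by rewrite vertex_x !inE multideg_x mnm1E eqb0 negbK eq_sym.
by rewrite vertex_y !inE multideg_y mnm1E eqb0 negbK eq_sym.
Qed.

Definition vars_in U A := [forall k in A, vertex k \in U].

Definition restrict U z : F := [ffun A : {set 'I_(n + n)} =>
  if vars_in U A then mfilter (fun u => vsupp u \subset U) (z A) : S^o else 0].

Lemma vars_inU1 U k A : vars_in U (k |: A) = (vertex k \in U) && vars_in U A.
Proof.
apply/forall_inP/andP => [kA|[kU /forall_inP AU] i].
  split; first by apply: kA; rewrite setU11.
  by apply/forall_inP => i iA; apply: kA; rewrite inE iA orbT.
by case/setU1P=> [->|/AU].
Qed.

Lemma mfilter_varM U k f : mfilter (fun u => vsupp u \subset U) ('X_k * f) =
  if vertex k \in U then 'X_k * mfilter (fun u => vsupp u \subset U) f else 0.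
Proof.
rewrite mulrC; case: ifP => kU.
  rewrite [RHS]mulrC; apply: mfilterM => u u'; rewrite msuppX inE => /eqP ->.
  by rewrite vsuppD subUset vsuppU sub1set kU andbT.
apply: mfilterM0 => u u'; rewrite msuppX inE => /eqP ->.
by rewrite vsuppD subUset vsuppU sub1set kU andbF.
Qed.

(** A term contracting a variable outside [U] dies on both sides: on the left through its dx_k, on
    the right through the factor 'X_k. *)
Lemma kdiff_restrict U z : kdiff X (restrict U z) = restrict U (kdiff X z).
Proof.
apply/ffunP => A; rewrite !ffunE; case: ifPn => AU; last first.
  rewrite big1 // => k kA; rewrite ffunE vars_inU1 (negPf AU) andbF.
  exact: scaler0.
rewrite raddf_sum; apply: eq_bigr => k kA; rewrite ffunE vars_inU1 AU andbT.
rewrite /GRing.scale /= -!mulrA raddfMsign /= mfilter_varM.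
by case: ifP => //; rewrite !mulr0.
Qed.

(* A class of degree h of the Koszul homology of S / J e, of internal degree
   2 h, involving only the vertices in U. *)
Definition koszul_class e U h := exists z : F,
  [/\ pform h z, forall A, z A \is h.-homog, restrict U z = z,
      forall A, J e (kdiff X z A)
    & ~ exists w : F, forall A, J e (z A - kdiff X w A)].

(** The cycle is kept; a form bounding it over [U'] would restrict to one bounding it over [U]. *)
Lemma koszul_class_mono t U U' h : ssrbool.symmetric t -> U \subset U' ->
  koszul_class (induced t U) U h -> koszul_class (induced t U') U' h.
Proof.
move=> ts UU' [z [zh zhomog zU dz nz]]; exists z; split=> //.
- rewrite -zU; apply/ffunP => A; rewrite !ffunE.
  have [AU|_] := boolP (vars_in U A); last by rewrite raddf0 if_same.
  rewrite ifT; last by apply/forall_inP => k /(forall_inP AU)/(subsetP UU').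
  apply: mfilter_id => u; rewrite mem_msupp_mfilter => /andP[uU _].
  exact: subset_trans UU'.
- move=> A; apply: bei_subrel (dz A); first exact: induced_sym.
  by move=> i j /and3P[iU jU ij]; apply/and3P; split=> //; apply: (subsetP UU').
case=> w wE; apply: nz; exists (restrict U w) => A.
rewrite -[in z A]zU kdiff_restrict !ffunE; case: ifP => AU; last first.
  by rewrite subrr; have [] := bei_ideal K (induced t U).
rewrite -raddfB /=; have := bei_restrict U (wE A); rewrite ffunE.
apply: bei_subrel; first exact: induced_sym.
by move=> i j /and3P[iU jU /and3P[_ _ ij]]; apply/and3P.
Qed.

(** Put f = x_v y_l - x_l y_v and z' = (x_v dy_l - x_l dy_v) /\ z, so d z' = f z modulo J_e. If z' =
    d w + f q modulo J_e, differentiating gives f (z - d q) in J_e, and regularity of f makes [z] a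
    boundary. *)
Lemma koszul_class_leaf t U v l h : ssrbool.symmetric t -> irreflexive t ->
  v \in U -> l \notin U -> t v l ->
  {in U, forall a, t l a -> a = v} ->
  {in U &, forall a b, t v a -> t v b -> a = b} ->
  koszul_class (induced t U) U h ->
  koszul_class (induced t (l |: U)) (l |: U) h.+1.
Proof.
move=> ts tirr vU lU vl lv vleaf [z [zh zhomog zU dz nz]].
set e := induced t U; set e' := induced t (l |: U).
have es : ssrbool.symmetric e by apply: induced_sym.
have e's : ssrbool.symmetric e' by apply: induced_sym.
have [J0 JD JM] := bei_ideal K e; have [J'0 J'D J'M] := bei_ideal K e'.
have Je g : J e g -> J e' g.
  apply: bei_subrel => // i j /and3P[iU jU ij].
  by apply/and3P; rewrite !inE iU jU !orbT.
pose z' : F := X (x v) *: kwedge (y l) z - X (x l) *: kwedge (y v) z.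
pose b : F := X (x v) *: kwedge (y l) (kdiff X z) -
              X (x l) *: kwedge (y v) (kdiff X z).
have dz' A : kdiff X z' A = edge_poly K v l * z A - b A.
  have -> : kdiff X z' = edge_poly K v l *: z - b.
    exact: (kdiff_kwedgeB X (X (x v)) (X (x l)) (y l) (y v) z).
  rewrite [LHS]ffunE; congr (_ + _); rewrite ffunE //.
have scaleE (c c' : S) (a a' : F) A :
    (c *: a - c' *: a') A = c * a A - c' * a' A by rewrite !ffunE.
have Jwedge k A : J e (kwedge k (kdiff X z) A).
  by rewrite [kwedge _ _ _]ffunE; case: ifP => // _; apply: (JM _ _ (dz _)).
have Jb A : J e (b A).
  by rewrite /b scaleE; apply: (idealB (bei_ideal K e)); apply: JM.
have wedge_restrict k : vertex k \in l |: U ->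
    restrict (l |: U) (kwedge k z) = kwedge k z.
  move=> kU; apply/ffunP => A; rewrite !ffunE.
  have [kA|_] := boolP (k \in A); last by rewrite raddf0 if_same.
  rewrite -[in vars_in _ A](setD1K kA) vars_inU1 kU /=.
  case: ifP => AU; last first.
    rewrite -zU ffunE ifF ?scaler0 //; apply: contraFF AU => /forall_inP AU.
    by apply/forall_inP => a aA; rewrite inE AU ?orbT.
  rewrite /GRing.scale /= raddfMsign /=; congr (_ * _); apply: mfilter_id => u.
  rewrite -zU ffunE; case: ifP => _; last by rewrite msupp0.
  by rewrite mem_msupp_mfilter => /andP[/subset_trans uU _]; apply/uU/subsetUr.
have wedge_homog k A : kwedge k z A \is h.-homog.
  by rewrite ffunE; case: ifP => _; rewrite ?rpredMsign ?rpred0.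
exists z'; split.
- have comb0 (c c' : S) (a a' : F) A :
      a A = 0 -> a' A = 0 -> (c *: a - c' *: a') A = 0.
    by rewrite scaleE => -> ->; rewrite !mulr0 subrr.
  by move=> A Ah; apply: comb0; apply: pform_kwedge Ah.
- have comb_homog i j (a a' : F) A : a A \is h.-homog -> a' A \is h.-homog ->
      ('X_i *: a - 'X_j *: a') A \is h.+1.-homog.
    have hX (i' : 'I_(n + n)) : 'X_i' \is [in K[n + n], 1.-homog].
      by rewrite dhomogX /= mdeg1.
    by move=> ha ha'; rewrite scaleE rpredB // -[h.+1]add1n; apply: dhomogM.
  by move=> A; apply: comb_homog.
- have comb_restrict i j (a a' : F) : vertex i \in l |: U -> vertex j \in l |: U ->
      restrict (l |: U) a = a -> restrict (l |: U) a' = a' ->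
      restrict (l |: U) ('X_i *: a - 'X_j *: a') = 'X_i *: a - 'X_j *: a'.
    move=> iU jU aU a'U; apply/ffunP => A; rewrite ffunE scaleE raddfB /=.
    rewrite !mfilter_varM iU jU -[in RHS]aU -[in RHS]a'U.
    by rewrite [_ A in RHS]ffunE [_ A in X in _ = _ - X]ffunE;
      case: ifP => _; rewrite ?mulr0 ?subr0.
  by apply: comb_restrict; rewrite ?wedge_restrict ?vertex_x ?vertex_y
    ?setU11 // inE vU orbT.
- move=> A; rewrite dz'; apply: (idealB (bei_ideal K e')); last exact: Je.
  rewrite mulrC; apply/J'M/bei_edge => //; apply/and3P; rewrite !inE eqxx vU orbT.
  by split.
case=> w wE.
(* J_e' is J_e plus the multiples of the binomial of [v] and [l], the only new edge. *)
have /fin_all_exists[q qE] A : exists q : S,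
    J e (z' A - kdiff X w A - edge_poly K v l * q).
  have [] := @bei_sub K n e' (fun g => exists q, J e (g - edge_poly K v l * q))
    (z' A - kdiff X w A) _ _ (wE A); last by move=> q; exists q.
    split; first by exists 0; rewrite mulr0 subr0.
      move=> f g [q qf] [q' qg]; exists (q + q').
      by rewrite mulrDr opprD addrACA; apply: JD.
    move=> a g [q qg]; exists (a * q).
    by rewrite mulrCA -mulrBr; apply: JM.
  move=> i j /and3P[/setU1P[->|iU] /setU1P[->|jU] ij].
  - by rewrite tirr in ij.
  - rewrite (lv _ jU ij) edge_polyN; exists (- 1).
    by rewrite mulrN1 opprK addNr.
  - rewrite ts in ij; rewrite (lv _ iU ij); exists 1.
    by rewrite mulr1 subrr.
  - by exists 0; rewrite mulr0 subr0; apply: bei_edge => //; apply/and3P.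
apply: nz; exists [ffun A => q A] => A.
apply: (@bei_leaf_regular _ _ e _ v l) => //.
- by apply: contraNneq lU => <-.
- by move=> a; rewrite /e /induced /= (negPf lU).
- by move=> a b0 /and3P[_ aU va] /and3P[_ bU vb]; apply: vleaf.
pose q' : F := [ffun A => q A].
(* The coefficients of [rho] lie in J_e, hence so do those of its differential, from which [w]
   disappears. *)
pose rho : F := (z' - kdiff X w) - edge_poly K v l *: q'.
have subE (c : S) (a a' : F) B : (a - c *: a') B = a B - c * a' B.
  by rewrite -[a]scale1r scaleE scale1r mul1r.
have Jrho B : J e (rho B).
  by rewrite /rho subE [q' B]ffunE -[kdiff X w]scale1r subE mul1r; apply: qE.
have dE (a a' : F) (c : S) :
    kdiff X (a - kdiff X w - c *: a') = kdiff X a - c *: kdiff X a'.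
  by rewrite 2!kdiffB kdiff_kdiff subr0 kdiffZ.
have rhoE : kdiff X rho A = edge_poly K v l * z A - b A - edge_poly K v l * kdiff X q' A.
  apply: etrans (congr1 (fun a : F => a A) (dE _ _ _)) _.
  exact: etrans (subE _ _ _ _) (congr1 (fun a => a - _) (dz' A)).
have arith (f a c d : S) : (a - c) * f = f * a - d - f * c + d by ring.
apply: (eq_ind_r (J e) _ (etrans (arith _ _ _ _) (congr1 (+%R^~ (b A)) (esym rhoE)))).
apply: JD; last exact: Jb.
rewrite ffunE big_mkcond; apply: ideal_sum (bei_ideal K e) _ => k _.
by case: ifP => // _; exact: (JM (ksign S k A * 'X_k) (rho (k |: A)) (Jrho _)).
Qed.

(** The class of the constant 1: boundaries and elements of J have no constant term in degree 0. *)
Lemma koszul_class_vertex t v : koszul_class (induced t [set v]) [set v] 0.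
Proof.
pose z : F := [ffun A => (A == set0)%:R].
have z0 : pform 0 z.
  by move=> A A0; rewrite ffunE (negPf (_ : A != set0)) // -cards_eq0.
exists z; split=> //.
- by move=> A; rewrite ffunE; case: eqP; rewrite ?rpred0 ?dhomog1.
- apply/ffunP => A; rewrite !ffunE; have [->|_] := eqVneq A set0; last first.
    by rewrite raddf0 if_same.
  rewrite ifT; last by apply/forall_inP => k; rewrite inE.
  apply: mfilter_id => u; rewrite -mpolyC1 msupp1 inE => /eqP ->.
  by apply/subsetP => w; rewrite inE mnmE !mnm0E.
- move=> A; rewrite ffunE big1 => [|k kA].
    by have [] := bei_ideal K (induced t [set v]).
  by rewrite ffunE setU_eq0 -cards_eq0 cards1 scaler0.
case=> w /(_ set0) wE.
suff : (z set0 - kdiff X w set0)@_0%MM = 0.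
  rewrite mcoeffB !ffunE eqxx mcoeff1 eqxx raddf_sum big1 ?subr0 => [|k _].
    by move/eqP; rewrite oner_eq0.
  rewrite /GRing.scale /= /ksign -mulrA raddfMsign /= rmorphM /=.
  by rewrite mcoeffX mnm1_eq0 mul0r mulr0.
apply: (@bei_sub K n _ (fun g => g@_0%MM = 0)) wE => [|i j _].
  split=> [|f g f0 g0|f g g0]; first by rewrite mcoeff0.
    by rewrite mcoeffD f0 g0 addr0.
  by rewrite rmorphM /= g0 mulr0.
rewrite edge_polyE mcoeffB !mcoeffX !mnmD_eq0 !mnm1_eq0 /=.
by rewrite subrr.
Qed.

End TreeKoszulCycles.

(** * Growing a Koszul class along a tree *)

Section TreeGrowth.
Variables (K : fieldType) (n : nat) (t : rel 'I_n).
Hypothesis t_sym : ssrbool.symmetric t.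
Hypothesis t_irr : irreflexive t.
Hypothesis t_acyclic : acyclic t.
Local Notation J := (@binomial_edge_ideal n K).
Implicit Types (D U : {set 'I_n}) (v l : 'I_n).

(** The growth invariant: the vertices of [U] outside [D] are leaves hanging on [D], so [D] is
    connected dominating in the tree on [U]. *)
Definition grown U := exists D h,
  [/\ {in D &, forall a b, connect (induced t D) a b},
      {in U :\: D, forall a, exists2 b, b \in D & t a b /\
         {in U, forall c, t a c -> c = b}},
      D \subset U, {in U &, forall a b, connect (induced t U) a b}
    & (#|D| <= h)%N /\ koszul_class K (induced t U) U h].

(** Two edges from [l] into the connected set [U] would close a cycle. *)
Lemma unique_attachment U l a b :
  {in U &, forall c c', connect (induced t U) c c'} -> l \notin U ->
  a \in U -> b \in U -> t l a -> t l b -> a = b.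
Proof.
move=> Uconn lU aU bU la lb.
have /connectP[p0 p0e bE] := Uconn a b aU bU; move: p0e bE.
case/shortenP=> p pe up _ bE.
have := t_acyclic (c := l :: a :: p); rewrite /ucycle /=.
rewrite la rcons_path (sub_path _ pe) -?bE ?[t b l]t_sym ?lb //=; last first.
  by move=> c c' /and3P[].
have -> : (l \notin a :: p).
  apply: contra lU; rewrite inE => /predU1P[->//|]; exact: (path_induced pe).
(* The size bound 2 on the cycle [l :: a :: p] forces [p] to be empty, that is a = b. *)
move: up => /= ->; move/(_ isT); by case: p {pe} bE.
Qed.

Lemma connect_induced_add D v a : {in D &, forall b c, connect (induced t D) b c} ->
  a \in D -> t v a -> {in v |: D &, forall b c, connect (induced t (v |: D)) b c}.
Proof.
move=> Dconn aD va.
have toa b : b \in v |: D -> connect (induced t (v |: D)) b a.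
  case/setU1P=> [->|bD].
    by apply/connect1/and3P; rewrite !inE eqxx aD orbT.
  exact: connect_subset (subsetUr _ _) (Dconn _ _ bD aD).
have cs := sym_connect_sym (induced_sym (v |: D) t_sym).
by move=> b c bU cU; apply: connect_trans (toa _ bU) _; rewrite cs toa.
Qed.

Lemma grown_step U v l : grown U -> v \in U -> l \notin U -> t v l ->
  grown (l |: U).
Proof.
move=> [D [h [Dconn Dleaf DU Uconn [Dh zU]]]] vU lU vl.
have lv : t l v by rewrite t_sym.
have lv_uniq : {in U, forall a, t l a -> a = v}.
  by move=> a aU la; apply: (unique_attachment Uconn lU).
have lD : l \notin D by apply: contra lU; apply: (subsetP DU).
have U'conn := connect_induced_add Uconn vU lv.
(* Stated for [D'] so as to serve both cases, [D] and [v |: D]. *)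
have leaves' D' : D \subset D' -> D' \subset v |: D -> v \in D' ->
    {in (l |: U) :\: D', forall a, exists2 b, b \in D' & t a b /\
       {in l |: U, forall c, t a c -> c = b}}.
  move=> DD' D'v vD' a; rewrite !inE => /andP[aD'].
  have [-> _|al /= aU] := eqVneq a l.
    exists v => //; split=> // c /setU1P[->|cU lc]; first by rewrite t_irr.
    exact: lv_uniq.
  have [|b bD [ab b_uniq]] := Dleaf a.
    by rewrite inE aU andbT; apply: contra aD'; apply: (subsetP DD').
  exists b; first exact: (subsetP DD').
  split=> // c /setU1P[-> al'|cU]; last exact: b_uniq.
  rewrite t_sym in al'; have av := lv_uniq a aU al'.
  by rewrite av vD' in aD'.
have [vD|vD] := boolP (v \in D).
  exists D, h; split=> //; first exact: (leaves' D (subxx _) (subsetUr _ _)).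
    exact: subset_trans DU (subsetUr _ _).
  by split=> //; apply: koszul_class_mono zU => //; apply: subsetUr.
have [|u uD [vu u_uniq]] := Dleaf v; first by rewrite inE vD.
exists (v |: D), h.+1; split=> //.
- exact: connect_induced_add Dconn uD vu.
- by apply: leaves'; rewrite ?subsetUr ?setU11.
- by rewrite subUset sub1set inE vU orbT (subset_trans DU) ?subsetUr.
split; first by rewrite cardsU1 vD.
apply: (koszul_class_leaf _ _ vU) => // a b aU bU va vb.
by rewrite (u_uniq a) // (u_uniq b).
Qed.

(** Growth starts from an edge: on a single vertex the class has degree 0, too small for a nonempty
    [D]. *)
Lemma grown_edge v l : t v l -> grown (l |: [set v]).
Proof.
move=> vl; have lv : t l v by rewrite t_sym.
have vl' : l \notin [set v] by rewrite inE; apply: contraTneq vl => ->; rewrite t_irr.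
exists [set v], 1%N; split.
- by move=> a b /set1P -> /set1P ->; apply: connect0.
- move=> a; rewrite !inE => /andP[/negPf ->]; rewrite orbF => /eqP ->.
  exists v; rewrite ?inE //; split=> // c /setU1P[->|/set1P//].
  by rewrite t_irr.
- exact: subsetUr.
- apply: connect_induced_add lv; rewrite ?set11 //.
  by move=> a b /set1P -> /set1P ->; apply: connect0.
split; first by rewrite cards1.
apply: (koszul_class_leaf _ _ (set11 v)) => //; last exact: koszul_class_vertex.
- by move=> a /set1P.
- by move=> a b /set1P -> /set1P ->.
Qed.

Lemma leaving_edge U a b : connect t a b -> a \in U -> b \notin U ->
  exists v l, [/\ v \in U, l \notin U & t v l].
Proof.
move=> /connectP[p + ->]; elim: p a => [|c p IH] a /=; first by move=> _ ->.
case/andP=> ac pe aU; have [cU|cU _] := boolP (c \in U); first exact: IH.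
by exists a, c.
Qed.

Lemma tree_koszul_class : connected_graph t -> (1 < n)%N ->
  exists (D : {set 'I_n}) h, [/\ connected_dominating t D, (#|D| <= h)%N
    & koszul_class K (induced t [set: 'I_n]) [set: 'I_n] h].
Proof.
move=> tconn n1.
suff [D [h [Dconn Dleaf _ _ [Dh zT]]]] : grown [set: 'I_n].
  exists D, h; split=> //; apply/andP; split.
    by apply/forall_inP => a aD; apply/forall_inP => b; apply: Dconn.
  apply/forall_inP => a; rewrite inE => aD.
  have [|b bD [ab _]] := Dleaf a; first by rewrite inE aD inE.
  by apply/existsP; exists b; rewrite bD.
have grow m U : (#|~: U| <= m)%N -> grown U -> (0 < #|U|)%N -> grown [set: 'I_n].
  elim: m U => [|m IH] U.
    rewrite leqn0 cards_eq0 => /eqP UT; rewrite -[U]setCK UT setC0; done.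
  move=> Um gU /card_gt0P[a aU]; have [UT|[b bU]] := set_0Vmem (~: U).
    by rewrite -[U]setCK UT setC0 in gU.
  rewrite inE in bU.
  have [v [l [vU lU vl]]] := leaving_edge (tconn a b) aU bU.
  apply: (IH (l |: U)); last by apply/card_gt0P; exists a; rewrite inE aU orbT.
    rewrite -ltnS; apply: leq_trans Um; apply: proper_card.
    rewrite properEneq setCS subsetUr andbT; apply: contraNneq lU => /setC_inj <-.
    exact: setU11.
  exact: grown_step vU lU vl.
pose a := Ordinal (ltnW n1); pose b := Ordinal n1.
have [v [l [_ _ vl]]] : exists v l, [/\ v \in [set a], l \notin [set a] & t v l].
  by apply: leaving_edge (tconn a b) _ _; rewrite inE.
by apply: grow (leqnn _) (grown_edge vl) _; rewrite cardsU1 cards1 addn1.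
Qed.

End TreeGrowth.

(** * The regularity bound for trees and the comparison of invariants *)

Lemma bei_mfilter_mdeg (K : fieldType) n (e : rel 'I_n) d f :
  binomial_edge_ideal K e f ->
  binomial_edge_ideal K e (mfilter (fun u => mdeg u == d) f).
Proof.
move/(bei_mfilter (fun a => mdeg a == d)).
by congr (binomial_edge_ideal K e _); apply: eq_mfilter => u; rewrite mdeg_multideg.
Qed.

Lemma tree_regularity (K : fieldType) n (t : rel 'I_n) (r : int) :
  simple_graph t -> connected_graph t -> acyclic t -> (1 < n)%N ->
  is_regularity (binomial_edge_ideal K t) r ->
  exists2 D : {set 'I_n}, connected_dominating t D & (#|D|%:Z <= r)%R.
Proof.
move=> [ts tirr] tconn tac n1 [F [[Fg Fr _] _ Fle]].
have [D [h [Dcd Dh [z [zh zhomog _ dz nz]]]]] := tree_koszul_class K ts tirr tac tconn n1.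
exists D => //; apply: (@le_trans _ _ h%:Z); first by rewrite lez_nat.
rewrite leNgt; apply/negP => rh; apply: nz.
have JT f : binomial_edge_ideal K (induced t setT) f <-> binomial_edge_ideal K t f.
  split; apply: bei_subrel => //; first by move=> i j /and3P[].
    exact: induced_sym.
  by move=> i j ij; apply/and3P; rewrite !inE.
have [||||A|w wE] := koszul_boundary (bei_ideal K t) Fg Fr (h := h) (e := h) (z := z).
- by move=> f; apply: bei_mfilter_mdeg.
(* A generator of F_h has degree at most h + r, which is below 2h because r < h. *)
- move=> k; have := Fle h (shift k).
  have /[swap]/[apply] : betti F h (shift k) != 0%N.
    by rewrite -lt0n card_gt0; apply/set0Pn; exists k; rewrite inE.
  lia.
- exact: zh.
- by move=> A; apply: zhomog.
- by apply/JT.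
- by exists w => A; apply/JT.
Qed.

(** For [G] complete the colon by 1 is already J_K, so the local v-number is 0 while the connected
    domination number is 1; this is why equality is asserted for [G] not complete. For n = 1 the
    regularity is 0 and the domination number 1, hence the condition 1 < n. *)
Theorem corollary2 (K : fieldType) (n : nat) (G : rel 'I_n)
    (n_gt0 : (0 < n)%N) (G_simple : simple_graph G)
    (G_connected : connected_graph G) :
  exists v vp : nat,
    [/\ is_v_number (binomial_edge_ideal K G) v,
        is_local_v_number (binomial_edge_ideal K G)
          (binomial_edge_ideal K (@complete_graph n)) vp,
        (v <= vp)%N,
        (vp <= connected_domination_number G)%N /\
          (~~ is_complete G -> vp = connected_domination_number G)
      & (1 < n)%N ->
        forall (T : rel 'I_n) (r : int),
          max_leaf_spanning_tree G T ->
          is_regularity (binomial_edge_ideal K T) r ->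
          ((connected_domination_number G)%:Z <= r)%R].
Proof.
have [Gs _] := G_simple.
have [D Dcd [-> Dmin]] := connected_dominationP G_connected.
have f_colon := bei_colon_dominating (K := K) n_gt0 Gs Dcd.
set f := \prod_(v in D) _ in f_colon.
have f_homog : f \is #|D|.-homog.
  have -> : f = 'X_[\sum_(v in D) U_(lshift n v)] by rewrite -mprodXE.
  by rewrite dhomogX /= mdeg_sum -sum1_card; under eq_bigr do rewrite mdeg1.
have JK_assoc : associated_prime (binomial_edge_ideal K G)
    (binomial_edge_ideal K (@complete_graph n)).
  by split; [exact: bei_complete_prime|exists f].
have [vp [vpP vp_min]] : exists vp, is_min (fun k => exists g : {mpoly K[n + n]},
    g \is k.-homog /\ same_ideal (colon (binomial_edge_ideal K G) g)
      (binomial_edge_ideal K (@complete_graph n))) vp.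
  by apply: ex_is_min; exists #|D|, f.
have [g [g_homog g_colon]] := vpP.
have [v [vP v_min]] : exists v, is_v_number (binomial_edge_ideal K G) v.
  by apply: ex_is_min; exists vp, g, (binomial_edge_ideal K (@complete_graph n)).
exists v, vp; split=> //.
- by apply: v_min; exists g, (binomial_edge_ideal K (@complete_graph n)).
- split; first by apply: vp_min; exists f.
  move=> Gnc; apply/eqP; rewrite eqn_leq vp_min; last by exists f.
  have [E Ecd /(leq_trans _) -> //] := dominating_of_colon G_simple Gnc n_gt0 g_homog g_colon.
  exact: Dmin.
- move=> n1 T r [[Tsimple TG Tconn Tac] _] Tr.
  have [E /andP[Econn Edom] Er] := tree_regularity Tsimple Tconn Tac n1 Tr.
  (* A connected dominating set of [T] is one of [G], as [T] is a spanning subgraph. *)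
  apply: le_trans Er; rewrite lez_nat; apply: Dmin; apply/andP; split.
    apply/forall_inP => a aE; apply/forall_inP => b bE.
    have /forall_inP/(_ a aE)/forall_inP/(_ b bE) := Econn.
    apply: connect_sub => c c' /and3P[cE c'E /TG cc'].
    exact/connect1/and3P.
  apply/forall_inP => a aE; have /forall_inP/(_ a aE)/existsP[b /andP[bE /TG ab]] := Edom.
  by apply/existsP; exists b; rewrite bE.
Qed.
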